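(* Let $(X,Q)$ be a principally polarized tropical abelian surface, $X=N_\mathbb{R}/M'$, and assume $(X,Q)$ is irreducible (i.e. not of product type). Let $\lambda:M'\to M$ be the isomorphism corresponding to $Q$, let $\{b_0,b_1,b_2,b_3\}\subseteq M$ be a complete system of representatives of $M/2\lambda(M')$, and let $\vartheta_{b_0},\dots,\vartheta_{b_3}$ be the tropical theta functions of second order defined below. Then the map $\psi:Y=X/\langle -1\rangle\to\mathbb{TP}^3$, $[x]\mapsto(\vartheta_{b_0}(x):\vartheta_{b_1}(x):\vartheta_{b_2}(x):\vartheta_{b_3}(x))$, is well defined and is a faithful embedding: it is injective, its image lies in the principal torus $\mathbb{R}^4/\mathbb{R}(1,1,1,1)\cong\mathbb{R}^3$, and the composite $N_\mathbb{R}\to X\to Y\xrightarrow{\psi}\mathbb{R}^3$ is unimodular.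
   Context: $M$ is a free $\mathbb{Z}$-module of rank $2$, $N=\mathrm{Hom}(M,\mathbb{Z})\subseteq N_\mathbb{R}=\mathrm{Hom}(M,\mathbb{R})$, $\langle\cdot,\cdot\rangle:M\times N_\mathbb{R}\to\mathbb{R}$ the pairing, $M'\subseteq N_\mathbb{R}$ a full lattice, and $X=N_\mathbb{R}/M'$ is a real torus with integral structure $N$. A polarization is a positive-definite symmetric bilinear form $Q$ on $N_\mathbb{R}$ with $Q(M'\times N)\subseteq\mathbb{Z}$; it corresponds to $\lambda:M'\to M$, $\lambda(u')=Q(u',\cdot)|_N$; $Q$ is principal if $\lambda$ is an isomorphism. An isomorphism of polarized tropical abelian varieties $(N_{1\mathbb{R}}/M_1',Q_1)\to(N_{2\mathbb{R}}/M_2',Q_2)$ is induced by a $\mathbb{Z}$-isomorphism $h:N_1\to N_2$ with $h_\mathbb{R}(M_1')=M_2'$ and $Q_2(h_\mathbb{R}x,h_\mathbb{R}y)=Q_1(x,y)$. The product of $(N_{i\mathbb{R}}/M_i',Q_i)$, $i=1,2$, is $((N_1\times N_2)_\mathbb{R}/(M_1'\times M_2'),Q_1\oplus Q_2)$. $(X,Q)$ is of product type if it is isomorphic to a product of two polarized tropical elliptic curves (one-dimensional polarized tropical abelian varieties), and irreducible otherwise. For $b\in M$, the tropical theta function of second order is $\vartheta_b(x)=\min_{u'\in M'}\big(2Q(x,u'+(2\lambda)_\mathbb{R}^{-1}(b))+Q(u'+(2\lambda)_\mathbb{R}^{-1}(b),u'+(2\lambda)_\mathbb{R}^{-1}(b))\big)$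 for $x\in N_\mathbb{R}$. $\mathbb{TP}^3=(\mathbb{T}^4\setminus\{(\infty,\dots,\infty)\})/\mathbb{R}(1,1,1,1)$ with $\mathbb{T}=\mathbb{R}\cup\{\infty\}$; the principal torus $\mathbb{R}^4/\mathbb{R}(1,1,1,1)$ is identified with $\mathbb{R}^3$ by $(x_0:\dots:x_3)\mapsto(x_1-x_0,x_2-x_0,x_3-x_0)$ with integral structure $\mathbb{Z}^3$. Unimodularity: a map $f:U\to\mathbb{R}^m$ on an open $U\subseteq N_\mathbb{R}$ is unimodular if every point of $U$ has an open neighborhood $U'$ and a finite polyhedral complex $\mathcal{C}$ of polyhedra rational with respect to $N$ with $U'$ open in $|\mathcal{C}|$, such that for each $\sigma\in\mathcal{C}$, $f|_{\sigma\cap U'}$ locally coincides with an affine map $x\mapsto A(x)+b$ where $A$ is linear with $A(N)\subseteq\mathbb{Z}^m$ and $A|_N:N\to\mathbb{Z}^m$ injective with torsion-free cokernel. *)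

(* Defs.v *)
From HB Require Import structures.
From mathcomp Require Import all_boot all_order all_algebra.
From mathcomp Require Import all_classical all_reals all_analysis.
Set Implicit Arguments. Unset Strict Implicit. Unset Printing Implicit Defensive.
Import Order.TTheory GRing.Theory Num.Theory.
Import numFieldNormedType.Exports.
Local Open Scope classical_set_scope.
Local Open Scope ring_scope.

(* Coordinates: N = Z^n inside N_R = R^n (row vectors 'rV[R]_n);
   M = Hom(N,Z) = Z^n inside M_R = R^n with pairing <m,x> = m *m x^T. *)

Section Defs.
Variable R : realType.

Definition intvec n (z : 'rV[int]_n) : 'rV[R]_n := map_mx (fun k : int => k%:~R) z.
Definition intmx m n (A : 'M[int]_(m, n)) : 'M[R]_(m, n) := map_mx (fun k : int => k%:~R) A.

(* the integral lattice Z^n (= N, or M via the pairing) *)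
Definition Nlat (n : nat) : set 'rV[R]_n := [set v | exists z : 'rV[int]_n, v = intvec z].
Arguments Nlat : clear implicits.

Definition dotv n (a x : 'rV[R]_n) : R := (a *m x^T) 0 0.

Definition lattice n (B : 'M[R]_n) : set 'rV[R]_n :=
  [set u | exists z : 'rV[int]_n, u = intvec z *m B].

Definition full_lattice n (L : set 'rV[R]_n) : Prop :=
  exists B : 'M[R]_n, \det B != 0 /\ L = lattice B.

Definition bil n (Q : 'M[R]_n) (x y : 'rV[R]_n) : R := (x *m Q *m y^T) 0 0.

Definition is_polarization n (M' : set 'rV[R]_n) (Q : 'M[R]_n) : Prop :=
  [/\ Q^T = Q,
      (forall x : 'rV[R]_n, x != 0 -> 0 < bil Q x x) &
      (forall u v, M' u -> Nlat n v -> exists k : int, bil Q u v = k%:~R)].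

(* lambda_R(u) = Q(u, .) as an element of M_R = R^n *)
Definition lam n (Q : 'M[R]_n) (u : 'rV[R]_n) : 'rV[R]_n := u *m Q.

Definition principal n (M' : set 'rV[R]_n) (Q : 'M[R]_n) : Prop :=
  {in M' &, injective (lam Q)} /\
  (forall m, Nlat n m <-> exists u, M' u /\ lam Q u = m).

(* polarized tropical elliptic curve R/rZ with Q1(x,y) = q x y, N1 = Z *)
Definition elliptic_data (r q : R) : Prop :=
  r != 0 /\ 0 < q /\ exists k : int, q * r = k%:~R.

Definition pair2 (a b : R) : 'rV[R]_2 := \row_(i < 2) (if i == ord0 then a else b).

Definition product_type (M' : set 'rV[R]_2) (Q : 'M[R]_2) : Prop :=
  exists (r1 q1 r2 q2 : R) (H : 'M[int]_2),
    [/\ elliptic_data r1 q1, elliptic_data r2 q2, H \in unitmx,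
        (forall u, M' u <-> lattice (diag_mx (pair2 r1 r2)) (u *m intmx H)) &
        (forall x y, bil (diag_mx (pair2 q1 q2)) (x *m intmx H) (y *m intmx H)
                     = bil Q x y)].

Definition irreducible_ppav (M' : set 'rV[R]_2) (Q : 'M[R]_2) : Prop :=
  ~ product_type M' Q.

Definition theta_term n (Q : 'M[R]_n) (b x u : 'rV[R]_n) : R :=
  let c := (2^-1 : R) *: (b *m invmx Q) in   (* c = (2 lambda)_R^{-1}(b) *)
  2 * bil Q x (u + c) + bil Q (u + c) (u + c).

Definition theta n (M' : set 'rV[R]_n) (Q : 'M[R]_n) (b x : 'rV[R]_n) : R :=
  inf [set theta_term Q b x u | u in M'].

(* equality of points of TP^3 with all coordinates finite *)
Definition tproj_eq (v w : 'I_4 -> R) : Prop := exists k : R, forall i, v i = w i + k.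

(* psi composed with N_R -> X -> Y, read in the principal torus R^3 *)
Definition psi_map (M' : set 'rV[R]_2) (Q : 'M[R]_2) (b : 'I_4 -> 'rV[R]_2)
  (x : 'rV[R]_2) : 'rV[R]_3 :=
  \row_(j < 3) (theta M' Q (b (lift ord0 j)) x - theta M' Q (b ord0) x).

Definition rat_polyhedron n (P : set 'rV[R]_n) : Prop :=
  exists s : seq ('rV[int]_n * R),
    P = [set x | forall p, p \in s -> dotv (intvec p.1) x <= p.2].

Definition face n (F P : set 'rV[R]_n) : Prop :=
  F !=set0 /\ exists (a : 'rV[R]_n) (c : R),
    (forall x, P x -> dotv a x <= c) /\ F = P `&` [set x | dotv a x = c].

Definition polyhedral_complex n k (C : 'I_k -> set 'rV[R]_n) : Prop :=
  [/\ (forall i, rat_polyhedron (C i)),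
      (forall i F, face F (C i) -> exists j, C j = F) &
      (forall i j, C i `&` C j = set0 \/ (face (C i `&` C j) (C i) /\ face (C i `&` C j) (C j)))].

Definition support n k (C : 'I_k -> set 'rV[R]_n) : set 'rV[R]_n :=
  [set x | exists i, C i x].

(* A : Z^n -> Z^m injective with torsion-free cokernel (row-vector convention) *)
Definition unimodular_lin n m (A : 'M[int]_(n, m)) : Prop :=
  (forall z : 'rV[int]_n, z *m A = 0 -> z = 0) /\
  (forall (y : 'rV[int]_m) (k : int), k != 0 ->
     (exists z : 'rV[int]_n, k *: y = z *m A) -> exists z : 'rV[int]_n, y = z *m A).

Definition unimodular n m (U : set 'rV[R]_n) (f : 'rV[R]_n -> 'rV[R]_m) : Prop :=
  forall p, U p ->
  exists (U' : set 'rV[R]_n) (k : nat) (C : 'I_k -> set 'rV[R]_n),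
    [/\ [/\ open U', U' p & U' `<=` U], polyhedral_complex C,
        (exists W : set 'rV[R]_n, open W /\ U' = W `&` support C) &
        (forall i q, C i q -> U' q ->
           exists V : set 'rV[R]_n, [/\ open V, V q &
             exists (A : 'M[int]_(n, m)) (b : 'rV[R]_m), unimodular_lin A /\
               forall x, C i x -> U' x -> V x -> f x = x *m intmx A + b])].

End Defs.
Arguments Nlat {R} n.

(* Main.v *)
Require Import Defs.
From HB Require Import structures.
From mathcomp Require Import all_boot all_order all_algebra.
From mathcomp Require Import all_classical all_reals all_analysis.
From mathcomp Require Import zify ring lra.
Set Implicit Arguments. Unset Strict Implicit. Unset Printing Implicit Defensive.
Import Order.TTheory GRing.Theory Num.Theory.
Import numFieldNormedType.Exports.
Local Open Scope classical_set_scope.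
Local Open Scope ring_scope.

(** Principality gives M' = Z^2 Q^-1, so theta_b(x) is the minimum of
    <w,x> + Q^-1(w,w)/4 over the integral vectors w congruent to b modulo 2.  By Selling
    reduction Q^-1 is a m^2 + b n^2 + c (m-n)^2 in a suitable basis with a, b, c >= 0, and
    irreducibility makes a, b, c positive.  Up to a common summand, 4 theta_b(x) is then the
    squared distance from a point t (a linear function of x) to a class of Z^2 modulo 2.
    The point t lies in a Delaunay triangle, whose vertices v_c represent three of the four
    classes; write t = sum_c lam_c v_c with weight 0 on the missing class.  Since the vertex
    differences are shortest in their classes, theta_i is minimal at v_i for the three
    classes i of the triangle, and in general it is bounded below by an explicit affine
    function of lam with matrix (min of the form on the class i + c)_(i,c).

    Unimodularity: the differences of the vertices of a Delaunay triangle generate Z^2.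
    Injectivity: the excess of theta over the lower bound is complementary to lam, while the
    matrix is negative definite on vectors of sum zero, so theta determines lam; and lam
    determines t up to sign and 2 Z^2. *)

(** * The classes modulo 2 and the Delaunay triangles *)

Lemma odd_abszB (m n : int) : odd `|m - n|%N = odd `|m|%N (+) odd `|n|%N.
Proof. lia. Qed.

Definition parity (w : int * int) : bool * bool := (odd `|w.1|%N, odd `|w.2|%N).
Definition class_add (c d : bool * bool) : bool * bool := (c.1 (+) d.1, c.2 (+) d.2).

Lemma sum_classes (V : nmodType) (F : bool * bool -> V) :
  \sum_c F c = F (false, false) + F (false, true) + F (true, false) + F (true, true).
Proof.
rewrite (eq_bigr (fun p => (fun x y => F (x, y)) p.1 p.2)); last by case.
rewrite -(pair_big xpredT xpredT (fun x y => F (x, y))) /=.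
by rewrite !big_bool /= !addrA; rewrite [RHS]addrC [in RHS](addrC _ (F (true, false))) !addrA
  [RHS]addrAC [in RHS](addrAC _ (F (false, true))) [LHS]addrAC.
Qed.

Section Energy.
Context {R : realType}.
Implicit Types (w : int * int) (t : R * R) (c d e : bool * bool)
  (lam : bool * bool -> R) (v : bool * bool -> int * int).

Definition qform (a b g x y : R) : R := a * x ^+ 2 + b * y ^+ 2 + g * (x - y) ^+ 2.

Definition zform (a b g : R) (w : int * int) : R := qform a b g w.1%:~R w.2%:~R.

(** With q the Selling form this is q(w - t) - q(t), the squared distance from [w] to [t] without
    the summand common to all [w]. Dropping q(t) makes it affine in [t]. *)
Definition energy (a b g : R) w t : R :=
  zform a b g w - 2 * (a * w.1%:~R * t.1 + b * w.2%:~R * t.2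
                       + g * (w.1%:~R - w.2%:~R) * (t.1 - t.2)).

(** The minimum of [zform] on the class [c] when the coefficients are nonnegative: every square is
    at least the parity of its base, and the 0-1 representative attains all three bounds. *)
Definition class_min (a b g : R) c : R := a * c.1%:R + b * c.2%:R + g * (c.1 (+) c.2)%:R.

Lemma sqr_ge_odd (m : int) : ((odd `|m|%N)%:R : R) <= m%:~R ^+ 2.
Proof.
rewrite -rmorphXn /= -(mulrz_nat (odd `|m|%N)) ler_int; nia.
Qed.

Lemma class_min_le (al be ga : R) w : 0 <= al -> 0 <= be -> 0 <= ga ->
  class_min al be ga (parity w) <= zform al be ga w.
Proof.
move=> ha hb hg; rewrite /class_min /zform /qform /parity /= -odd_abszB -intrB.
by rewrite !lerD // ler_wpM2l // sqr_ge_odd.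
Qed.

Definition vsub (w v : int * int) : int * int := (w.1 - v.1, w.2 - v.2).
Definition vopp_if (s : bool) (w : int * int) : int * int :=
  if s then (- w.1, - w.2) else w.
Definition vshift (k w : int * int) : int * int := (w.1 + 2 * k.1, w.2 + 2 * k.2).

Lemma parity_vsub (w v : int * int) : parity (vsub w v) = class_add (parity w) (parity v).
Proof. by rewrite /parity /class_add /= !odd_abszB. Qed.

Lemma parity_eqP (w v : int * int) :
  parity w = parity v <-> exists k, w = vshift k v.
Proof.
case: w v => [w1 w2] [v1 v2]; rewrite /parity /vshift /=; split.
  move=> [h1 h2].
  have [k1 e1] : exists k, w1 = v1 + 2 * k by exists ((w1 - v1) %/ 2)%Z; lia.
  have [k2 e2] : exists k, w2 = v2 + 2 * k by exists ((w2 - v2) %/ 2)%Z; lia.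
  by exists (k1, k2); rewrite /= e1 e2.
by move=> [[k1 k2]] /= [-> ->]; congr pair; lia.
Qed.

Lemma parity_vopp_if s w : parity (vopp_if s w) = parity w.
Proof. by case: s => //; rewrite /parity /= !abszN. Qed.

(** All three squares in the Selling form are then at most 1, which makes [w] minimal in its
    class. *)
Definition short (w : int * int) : bool :=
  [&& `|w.1| <= 1, `|w.2| <= 1 & `|w.1 - w.2| <= 1].

Lemma zform_short (al be ga : R) w : short w ->
  zform al be ga w = class_min al be ga (parity w).
Proof.
case: w => x y; rewrite /short /= => /and3P[hx hy hxy].
rewrite /class_min /zform /qform /parity /= -odd_abszB -intrB.
have sq (z : int) : `|z| <= 1 -> (z%:~R : R) ^+ 2 = (odd `|z|%N)%:R.
  move=> hz; rewrite -rmorphXn /= -(mulrz_nat (odd `|z|%N)); congr (_ %:~R).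
  have : z = 0 \/ z = 1 \/ z = -1 by lia.
  by move=> [-> | [-> | ->]].
by rewrite !sq.
Qed.

(** Each summand of [zform] dominates the matching one of [class_min], so all three are equal;
    dividing by the positive coefficients bounds each square by 1. *)
Lemma short_zform_le (al be ga : R) w : 0 < al -> 0 < be -> 0 < ga ->
  zform al be ga w <= class_min al be ga (parity w) -> short w.
Proof.
case: w => x y ha hb hg; rewrite /class_min /zform /qform /parity /= -odd_abszB -intrB.
have sx := sqr_ge_odd x; have sy := sqr_ge_odd y; have sxy := sqr_ge_odd (x - y).
rewrite -(ler_pM2l ha) in sx; rewrite -(ler_pM2l hb) in sy.
rewrite -(ler_pM2l hg) in sxy => h.
have sq (z : int) : (z%:~R : R) ^+ 2 <= (odd `|z|%N)%:R -> `|z| <= 1.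
  by rewrite -rmorphXn /= -(mulrz_nat (odd `|z|%N)) ler_int; nia.
apply/and3P; split; apply: sq.
- by rewrite -(ler_pM2l ha); lra.
- by rewrite -(ler_pM2l hb); lra.
- by rewrite -(ler_pM2l hg); lra.
Qed.

(** The weights are indexed by all four classes, with weight 0 on the missing class [e]. The value
    [v e] is a placeholder of the right parity, so that formulas need not single out [e]. *)
Definition delaunay e (lam : bool * bool -> R) (v : bool * bool -> int * int) t :=
  [/\ (forall c, parity (v c) = c),
      (forall c, 0 <= lam c) /\ \sum_c lam c = 1,
      lam e = 0,
      t = (\sum_c lam c * (v c).1%:~R, \sum_c lam c * (v c).2%:~R) &
      (forall c d, c != e -> d != e -> short (vsub (v c) (v d)))].

Section Triangle.
Variables (al be ga : R).
Hypotheses (al0 : 0 < al) (be0 : 0 < be) (ga0 : 0 < ga).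

(** The energy is affine in [t], and at [t = v c] it equals q(w - v c) - q(v c). *)
Lemma energy_barycentric lam v t w :
  \sum_c lam c = 1 ->
  t = (\sum_c lam c * (v c).1%:~R, \sum_c lam c * (v c).2%:~R) ->
  energy al be ga w t =
  \sum_c lam c * (zform al be ga (vsub w (v c)) - zform al be ga (v c)).
Proof.
rewrite sum_classes => hl ->; rewrite /energy !sum_classes /zform /qform /= !intrB.
have -> : lam (true, true) = 1 - lam (false, false) - lam (false, true) - lam (true, false).
  by rewrite -hl; ring.
by ring.
Qed.

(** The right-hand side of [energy_barycentric] with q(w - v c) replaced by its minimum over the
    class of w - v c. *)
Definition lower (lam : bool * bool -> R) (v : bool * bool -> int * int) i : R :=
  \sum_c lam c * (class_min al be ga (class_add i c) - zform al be ga (v c)).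

Lemma lower_le e lam v t w : delaunay e lam v t ->
  lower lam v (parity w) <= energy al be ga w t.
Proof.
move=> [pv [l0 l1] _ ht _]; rewrite (energy_barycentric _ _ ht) //.
apply: ler_sum => c _; apply: ler_wpM2l => //; rewrite lerD2r.
by rewrite -[X in class_add _ X](pv c) -parity_vsub class_min_le // ltW.
Qed.

(** Differences of triangle vertices are short, hence minimal in their classes; the term at [e] has
    weight 0. *)
Lemma lower_vertex e lam v t i : delaunay e lam v t -> i != e ->
  energy al be ga (v i) t = lower lam v i.
Proof.
move=> [pv [l0 l1] le ht sh] hi; rewrite (energy_barycentric _ l1 ht).
apply: eq_bigr => c _; have [->|ce] := eqVneq c e; first by rewrite le !mul0r.
by rewrite zform_short ?sh // parity_vsub !pv.
Qed.

(* Equality in [lower_le] forces every term with positive weight to be extremal. *)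
Lemma short_of_minimizer e lam v t w c : delaunay e lam v t ->
  energy al be ga w t <= lower lam v (parity w) -> 0 < lam c ->
  short (vsub w (v c)).
Proof.
move=> [pv [l0 l1] le ht sh]; rewrite (energy_barycentric _ l1 ht) /lower -subr_ge0.
rewrite -sumrB (bigD1 c) //= => h lc.
apply: (@short_zform_le al be ga) => //; rewrite parity_vsub pv.
have : \sum_(i | i != c) (lam i * (class_min al be ga (class_add (parity w) i)
    - zform al be ga (v i)) - lam i * (zform al be ga (vsub w (v i))
    - zform al be ga (v i))) <= 0.
  apply: sumr_le0 => d _; rewrite -mulrBr; apply: mulr_ge0_le0 => //.
  rewrite opprB addrA subrK subr_le0.
  by rewrite -[X in class_add _ X](pv d) -parity_vsub class_min_le // ltW.
move=> h2; rewrite -(ler_pM2l lc); lra.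
Qed.

(** Each of the three splittings of the classes into two pairs carries one coefficient. Weights of
    total 0 sum to S and -S on the two pairs, which contributes -2 S^2 times the coefficient. If all
    three S vanish, so do the weights. *)
Lemma class_form_neg (nu : bool * bool -> R) :
  \sum_c nu c = 0 ->
  0 <= \sum_i nu i * \sum_c nu c * class_min al be ga (class_add i c) ->
  forall c, nu c = 0.
Proof.
rewrite !sum_classes /class_min /class_add /=.
set x := nu (false, false); set y := nu (false, true).
set z := nu (true, false); set w := nu (true, true) => h.
have -> : w = - x - y - z by lra.
move=> H.
have h1 : al * (x + y) ^+ 2 + be * (x + z) ^+ 2 + ga * (y + z) ^+ 2 <= 0.
  by move: H; rewrite !(mulr0, mulr1, addr0, add0r); nra.
have p1 : 0 <= al * (x + y) ^+ 2 by rewrite mulr_ge0 ?sqr_ge0 // ltW.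
have p2 : 0 <= be * (x + z) ^+ 2 by rewrite mulr_ge0 ?sqr_ge0 // ltW.
have p3 : 0 <= ga * (y + z) ^+ 2 by rewrite mulr_ge0 ?sqr_ge0 // ltW.
have z0 (k u : R) : 0 < k -> k * u ^+ 2 <= 0 -> u = 0.
  by move=> k0; rewrite pmulr_rle0 // => /(conj (sqr_ge0 u))/andP/le_anti/esym/eqP;
     rewrite sqrf_eq0 => /eqP.
have e1 := z0 _ _ al0 (ltac:(lra) : al * (x + y) ^+ 2 <= 0).
have e2 := z0 _ _ be0 (ltac:(lra) : be * (x + z) ^+ 2 <= 0).
have e3 := z0 _ _ ga0 (ltac:(lra) : ga * (y + z) ^+ 2 <= 0).
by move=> [[] []]; rewrite -/x -/y -/z -/w; lra.
Qed.

Definition is_min c t (m : R) :=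
  (exists2 w, parity w = c & energy al be ga w t = m) /\
  (forall w, parity w = c -> m <= energy al be ga w t).

Lemma is_min_lower e lam v t m c : delaunay e lam v t -> is_min c t m ->
  lower lam v c <= m /\ (c != e -> m = lower lam v c).
Proof.
move=> D [[w pw <-] mw]; split; first by rewrite -pw; exact: lower_le D.
move=> ce; apply/le_anti; rewrite -{2}pw (lower_le w D) andbT.
by rewrite -(lower_vertex D ce) mw //; case: D.
Qed.

(* [lower lam v] depends on [lam] affinely through the class matrix, up to a
   constant, and the excess of the minimum over it is complementary to [lam]. *)
Lemma weights_unique e lam v t e' lam' v' t' (m m' : bool * bool -> R) k :
  delaunay e lam v t -> delaunay e' lam' v' t' ->
  (forall c, is_min c t (m c)) -> (forall c, is_min c t' (m' c)) ->
  (forall c, m c = m' c + k) -> lam =1 lam'.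
Proof.
move=> D D' M M' mk.
(* The bracket is the difference of the two values of [lower - m], which are nonpositive. The
   products with their own weights vanish and the mixed ones have the right sign. The subtracted
   constant does not depend on [c], so it drops out of the sum over [c]. *)
have E c : (lam c - lam' c) * (\sum_d (lam d - lam' d) * class_min al be ga (class_add c d)
   - (k + \sum_d lam d * zform al be ga (v d) - \sum_d lam' d * zform al be ga (v' d))) >= 0.
  have [le1 eq1] := is_min_lower D (M c); have [le2 eq2] := is_min_lower D' (M' c).
  have -> : \sum_d (lam d - lam' d) * class_min al be ga (class_add c d)
   - (k + \sum_d lam d * zform al be ga (v d) - \sum_d lam' d * zform al be ga (v' d))
   = (lower lam v c - m c) - (lower lam' v' c - m' c).
    rewrite mk /lower.
    under eq_bigr do rewrite mulrBl.
    under [X in _ = X - _ - _]eq_bigr do rewrite mulrBr.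
    under [X in _ = _ - (X - _)]eq_bigr do rewrite mulrBr.
    by rewrite !sumrB; lra.
  have l0 : lam c >= 0 by case: D => _ [].
  have l0' : lam' c >= 0 by case: D' => _ [].
  have h1 : lam c * (lower lam v c - m c) = 0.
    have [ce|/eq1 ->] := eqVneq c e; last by rewrite subrr mulr0.
    by case: D => _ _ le _ _; rewrite ce le mul0r.
  have h2 : lam' c * (lower lam' v' c - m' c) = 0.
    have [ce|/eq2 ->] := eqVneq c e'; last by rewrite subrr mulr0.
    by case: D' => _ _ le _ _; rewrite ce le mul0r.
  by nra.
move=> c; apply/eqP; rewrite -subr_eq0; apply/eqP.
apply: (@class_form_neg (fun c => lam c - lam' c)).
  by rewrite sumrB; case: D => _ [_ ->] _ _ _; case: D' => _ [_ ->] _ _ _; rewrite subrr.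
have := @sumr_ge0 R _ (index_enum _) xpredT _ (fun c _ => E c).
under eq_bigr do rewrite mulrBr.
rewrite sumrB -mulr_suml sumrB.
by case: D => _ [_ ->] _ _ _; case: D' => _ [_ ->] _ _ _; rewrite subrr mul0r subr0.
Qed.

End Triangle.

(* The big triangle with vertices (0,0), (2,0), (2,2) is a fundamental domain of the
   plane modulo -1 and 2Z^2; its medial subdivision consists of one Delaunay triangle
   for every missing class [e]. *)
Definition std_vertex e c : int * int :=
  match c with
  | (true, false) => (1, 0)
  | (true, true) => (1, 1)
  | (false, true) => (2, 1)
  | (false, false) =>
      match e with
      | (true, true) => (2, 0)
      | (true, false) => (2, 2)
      | _ => (0, 0)
      end
  end.

Definition vertex e (s : bool) (k : int * int) c := vshift k (vopp_if s (std_vertex e c)).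

Lemma delaunay_std t : 0 <= t.2 -> t.2 <= t.1 -> t.1 <= 2 ->
  exists e lam, delaunay e lam (std_vertex e) t.
Proof.
case: t => x y /= h0 h1 h2.
pose mk (a b c d : R) (i : bool * bool) :=
  match i with (false, false) => a | (true, false) => b | (true, true) => c | _ => d end.
have P e c : parity (std_vertex e c) = c by case: e c => [[] []] [[] []].
have S e : forall c d, c != e -> d != e ->
    short (vsub (std_vertex e c) (std_vertex e d)).
  by case: e => [[] []] [[] []] [[] []].
have N (l : bool * bool -> R) : 0 <= l (false, false) -> 0 <= l (false, true) ->
   0 <= l (true, false) -> 0 <= l (true, true) -> forall c, 0 <= l c.
  by move=> ? ? ? ? [[] []].
(* The lines x = 1, y = 1 and x - y = 1 join the midpoints of the sides of the big triangle; the
   weights are the barycentric coordinates in the piece containing the point. *)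
have [hx|hx] := leP x 1.
  exists (false, true), (mk (1 - x) (x - y) y 0); split=> //.
  - by split; [refine (N _ _ _ _ _) => /=; lra | rewrite sum_classes /=; lra].
  - by rewrite !sum_classes /=; congr pair; lra.
  - exact: S.
have [hy|hy] := leP 1 y.
  exists (true, false), (mk (y - 1) 0 (2 - x) (x - y)); split=> //.
  - by split; [refine (N _ _ _ _ _) => /=; lra | rewrite sum_classes /=; lra].
  - by rewrite !sum_classes /=; congr pair; lra.
  - exact: S.
have [hxy|hxy] := leP 1 (x - y).
  exists (true, true), (mk (x - y - 1) (2 - x) 0 y); split=> //.
  - by split; [refine (N _ _ _ _ _) => /=; lra | rewrite sum_classes /=; lra].
  - by rewrite !sum_classes /=; congr pair; lra.
  - exact: S.
exists (false, false), (mk 0 (1 - y) (1 - x + y) (x - 1)); split=> //.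
- by split; [refine (N _ _ _ _ _) => /=; lra | rewrite sum_classes /=; lra].
- by rewrite !sum_classes /=; congr pair; lra.
- exact: S.
Qed.

Definition topp_if (s : bool) t : R * R := if s then (- t.1, - t.2) else t.
Definition tshift (k : int * int) t : R * R := (t.1 + 2 * k.1%:~R, t.2 + 2 * k.2%:~R).

Lemma reduce_point t : exists (s : bool) (k : int * int) (t0 : R * R),
  [/\ 0 <= t0.2, t0.2 <= t0.1, t0.1 <= 2 & t = tshift k (topp_if s t0)].
Proof.
case: t => x y.
have fl (z : R) : exists (k : int) (r : R), [/\ 0 <= r, r <= 2 & z = r + 2 * k%:~R].
  exists (Num.floor (z / 2)), (z - 2 * (Num.floor (z / 2))%:~R).
  have := floor_itv (z / 2) => /andP[h1 h2].
  by rewrite intrD in h2; split; lra.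
have [k1 [r1 [h1 h2 ->]]] := fl x; have [k2 [r2 [h3 h4 ->]]] := fl y.
have [h|h] := leP r2 r1; first by exists false, (k1, k2), (r1, r2).
(* The half of the square above the diagonal is carried to the half below by the reflection in the
   centre (1, 1). *)
exists true, (k1 + 1, k2 + 1), (2 - r1, 2 - r2); rewrite /tshift /= !intrD.
by split; [lra | lra | lra | congr pair; lra].
Qed.

(** The triangle of [t] is the image of that of the reduced point [t0] and has the same weights, so
    points with equal weights can be compared in standard position. *)
Lemma delaunay_exists t : exists s k e t0 lam,
  [/\ t = tshift k (topp_if s t0), delaunay e lam (std_vertex e) t0 &
      delaunay e lam (vertex e s k) t].
Proof.
have [s [k [t0 [h1 h2 h3 ->]]]] := reduce_point t.
have [e [lam D]] := delaunay_std h1 h2 h3.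
exists s, k, e, t0, lam; split=> //; case: D => [P [l0 l1] le -> sh]; split=> //.
- move=> c; rewrite -[RHS](P c) -[RHS](parity_vopp_if s).
  by apply/parity_eqP; exists k.
- move: l1; rewrite !sum_classes => l1.
  have -> : lam (true, true) = 1 - lam (false, false) - lam (false, true) - lam (true, false).
    by rewrite -l1; ring.
  rewrite /vertex /vshift /tshift /vopp_if /topp_if.
  by case: s => /=; congr pair; rewrite !intrD ?intrM ?intrN; ring.
- move=> c d ce de; have := sh c d ce de; have := sh d c de ce.
  rewrite /vertex; move: (std_vertex e c) (std_vertex e d) => [x1 x2] [y1 y2].
  by case: s; rewrite /short /vsub /vshift /vopp_if /=; lia.
Qed.

(* Coinciding weights whose triangles miss different classes live on a common edge of the
   big triangle, and the two copies of this edge are exchanged by a point reflection. *)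
Lemma std_injective e lam t e' t' :
  delaunay e lam (std_vertex e) t -> delaunay e' lam (std_vertex e') t' ->
  exists s k, t' = tshift k (topp_if s t).
Proof.
move=> [_ [_ l1] le -> _] [_ _ le' -> _].
have [<-|ee] := eqVneq e e'.
  by exists false, (0, 0); rewrite /tshift /= !mulr0 !addr0.
(* Only the vertex of class 0 depends on the missing class, so without weight there the two points
   coincide. *)
have [l00|l00] := eqVneq (lam (false, false)) 0.
  exists false, (0, 0); rewrite /tshift /= !mulr0 !addr0 !sum_classes l00 /=.
  by rewrite !mul0r.
exists true; move: l1 le le' l00 ee; rewrite !sum_classes /tshift /=.
(* The remaining weight sits on one edge midpoint m; the reflection in m is t -> 2 m - t, so the
   shift [k] is m itself. *)
move: e e' => [[] []] [[] []] //= l1 l2 l3 /eqP l4 _ //;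
  first [by exists (1, 0); congr pair => /=; lra
        |by exists (1, 1); congr pair => /=; lra
        |by exists (2, 1); congr pair => /=; lra].
Qed.
End Energy.

(** The relation is [Prop]-valued and total only on [s], so as to cover the comparison of two
    energies on a whole cell of an arrangement. *)
Lemma preorder_min (T : eqType) (le : T -> T -> Prop) (s : seq T) :
  (forall x y z, le x y -> le y z -> le x z) ->
  {in s &, forall x y, le x y \/ le y x} -> s != [::] ->
  exists2 x, x \in s & {in s, forall y, le x y}.
Proof.
move=> tr; elim: s => // a s IH tot _.
have [->|s0] := eqVneq s [::].
  exists a; rewrite ?inE // => y; rewrite inE => /eqP->.
  by case: (tot a a) => //; rewrite inE eqxx.
have [|x xs Hx] := IH _ s0; first by move=> x y xs ys; apply: tot; rewrite inE ?xs ?ys orbT.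
case: (tot a x); rewrite ?inE ?eqxx ?xs ?orbT // => h.
  exists a; rewrite ?inE ?eqxx // => y; rewrite inE => /predU1P[->|/Hx]; last exact: tr.
  by case: (tot a a) => //; rewrite inE eqxx.
exists x; rewrite ?inE ?xs ?orbT // => y; rewrite inE => /predU1P[->//|]; exact: Hx.
Qed.

Lemma class_addcc (c : bool * bool) : class_add c c = (false, false).
Proof. by rewrite /class_add !addbb. Qed.

Lemma class_add_eq0 (c d : bool * bool) : (class_add c d == (false, false)) = (c == d).
Proof. by case: c d => [[] []] [[] []]. Qed.

Definition short_vectors : seq (int * int) :=
  [:: (0, 0); (1, 0); (-1, 0); (0, 1); (0, -1); (1, 1); (-1, -1)].

Lemma short_cases (w : int * int) : short w -> w \in short_vectors.
Proof.
case: w => x y; rewrite /short /= => /and3P[hx hy hxy].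
have C (z : int) : `|z| <= 1 -> z = -1 \/ z = 0 \/ z = 1 by lia.
by move: hxy; case: (C _ hx) => [|[]] ->; case: (C _ hy) => [|[]] ->.
Qed.

Lemma short_even (w : int * int) : short w -> parity w = (false, false) -> w = (0, 0).
Proof.
move=> /short_cases sw /eqP pw; apply/eqP.
have /allP/(_ _ sw) : all (fun w => (parity w == (false, false)) ==> (w == (0, 0)))
  short_vectors by [].
by rewrite pw.
Qed.

(** The nonzero short vectors are (1,0), (0,1), (1,1) and their opposites, one pair for each nonzero
    class; the claim is a finite check on them. *)
Lemma short_det (a b : int * int) : short a -> short b ->
  parity a != (false, false) -> parity b != (false, false) -> parity a != parity b ->
  `|a.1 * b.2 - a.2 * b.1| = 1.
Proof.
move=> /short_cases sa /short_cases sb pa pb pab; apply/eqP.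
pose P a b := [|| parity a == (false, false), parity b == (false, false),
  parity a == parity b | `|a.1 * b.2 - a.2 * b.1| == 1].
have /allP/(_ _ sa)/allP/(_ _ sb) : all (fun a => all (P a) short_vectors) short_vectors by [].
by rewrite /P (negbTE pa) (negbTE pb) (negbTE pab).
Qed.

Definition int_range (B : nat) : seq int := [seq k%:Z - B%:Z | k <- iota 0 (2 * B).+1].

Lemma mem_int_range B k : (k \in int_range B) = (`|k| <= B%:Z).
Proof.
apply/mapP/idP => [[m]|h]; first by rewrite mem_iota => /andP[_ h] ->; lia.
by exists (absz (k + B%:Z)); rewrite ?mem_iota; lia.
Qed.

Definition box (B : nat) : seq (int * int) :=
  [seq (i, j) | i <- int_range B, j <- int_range B].

Lemma mem_box B (w : int * int) : (w \in box B) = (`|w.1| <= B%:Z) && (`|w.2| <= B%:Z).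
Proof.
case: w => i j; rewrite -!mem_int_range /=.
by apply/allpairsP/andP => [[[x y] /= [? ? [-> ->]]]|[? ?]] //; exists (i, j).
Qed.

(** * Energy minima of the classes: separation of points, symmetries and existence *)

Section Minima.
Context {R : realType}.
Implicit Types (w : int * int) (t : R * R) (c d e : bool * bool)
  (lam : bool * bool -> R) (v : bool * bool -> int * int).

(** Equality of the images in Y, in the coordinates where the lattice is 2 Z^2. *)
Definition same_point t t' := exists s k, t' = tshift k (topp_if s t).

Lemma same_point_sym t t' : same_point t t' -> same_point t' t.
Proof.
move=> [s [k ->]]; exists s, (vopp_if (~~ s) k); case: t s => x y [];
  by rewrite /tshift /=; congr pair => /=; rewrite ?intrN; ring.
Qed.

Lemma same_point_trans t t' t'' : same_point t t' -> same_point t' t'' -> same_point t t''.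
Proof.
move=> [s [k ->]] [s' [k' ->]].
exists (s (+) s'), (vopp_if s' k + k'); case: t s s' => x y [] [];
  by rewrite /tshift /=; congr pair => /=; rewrite ?intrD ?intrN; ring.
Qed.

Lemma norm_int_le_sqr (m : int) (K : R) (B : nat) : K <= B%:R ->
  (m%:~R : R) ^+ 2 <= K -> `|m| <= B%:Z.
Proof.
move=> KB h; have : (m ^+ 2)%:~R <= (B%:Z)%:~R :> R.
  by rewrite rmorphXn /= (le_trans h).
rewrite ler_int; nia.
Qed.

Section Positive.
Variables (al be ga : R).
Hypotheses (al0 : 0 < al) (be0 : 0 < be) (ga0 : 0 < ga).

Lemma minima_injective t t' (m m' : bool * bool -> R) k :
  (forall c, is_min al be ga c t (m c)) -> (forall c, is_min al be ga c t' (m' c)) ->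
  (forall c, m c = m' c + k) -> same_point t t'.
Proof.
move=> M M' mk.
have [s [k1 [e [t0 [lam [E D0 D]]]]]] := delaunay_exists t.
have [s' [k1' [e' [t0' [lam' [E' D0' D']]]]]] := delaunay_exists t'.
have ll : lam' = lam.
  by apply/esym/funext; apply: (weights_unique al0 be0 ga0 D D' M M' mk).
have st0 : same_point t0 t by exists s, k1.
have st0' : same_point t0' t' by exists s', k1'.
apply: same_point_trans (same_point_sym st0) _; apply: same_point_trans st0'.
by rewrite ll in D0'; apply: std_injective D0 D0'.
Qed.

(** When [t] lies on an edge or at a vertex, the minimizers need not be the triangle vertices.
    Relative to a vertex [c0] of positive weight all of them outside [e] are short, and the one of
    class [c0] is that vertex itself. The others differ from it by short vectors of distinct nonzero
    classes. *)
Lemma minimizers_unimodular t (w : bool * bool -> int * int) :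
  (forall c, parity (w c) = c) ->
  (forall c (v : int * int), parity v = c -> energy al be ga (w c) t <= energy al be ga v t) ->
  exists c0 c1 c2, let a := vsub (w c1) (w c0) in let b := vsub (w c2) (w c0) in
    `|a.1 * b.2 - a.2 * b.1| = 1.
Proof.
move=> pw mw; have [s [k [e [t0 [lam [_ _ D]]]]]] := delaunay_exists t.
have [pv [l0 l1] le _ _] := D.
have [c0 lc0] : exists c0, 0 < lam c0.
  apply: contrapT => /forallNP h; have : \sum_c lam c = 0.
    by apply: big1 => c _; apply/le_anti; rewrite l0 leNgt andbT; apply/negP/h.
  by rewrite l1 => /eqP; rewrite oner_eq0.
have ec0 : c0 != e by apply: contraTneq lc0 => ->; rewrite le ltxx.
have sh c : c != e -> short (vsub (w c) (vertex e s k c0)).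
  move=> ce; apply: (short_of_minimizer al0 be0 ga0 D _ lc0).
  by rewrite pw -(lower_vertex al be ga D ce) mw.
have [c1 [c2 [h1 h2 h01 h02 h12]]] : exists c1 c2,
    [/\ c1 != e, c2 != e, c1 != c0, c2 != c0 & c1 != c2].
  move: (e) (c0) ec0 => [[] []] [[] []] // _;
    first [by exists (true, true), (true, false) | by exists (true, true), (false, true)
    | by exists (true, true), (false, false) | by exists (true, false), (false, true)
    | by exists (true, false), (false, false) | by exists (false, true), (false, false)].
have e0 : w c0 = vertex e s k c0.
  have := short_even (sh _ ec0); rewrite parity_vsub pw pv.
  case: (w c0) (vertex e s k c0) => [x y] [x' y'] /(_ (class_addcc _))[].
  by move=> /subr0_eq -> /subr0_eq ->.
exists c0, c1, c2 => a b; rewrite {}/a {}/b; apply: short_det.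
- by rewrite e0 sh.
- by rewrite e0 sh.
- by rewrite parity_vsub !pw class_add_eq0.
- by rewrite parity_vsub !pw class_add_eq0.
- by rewrite !parity_vsub !pw; move: (c1) (c2) (c0) h12 => [[] []] [[] []] [[] []].
Qed.

(** Translation by 2k preserves w - t, so the energy changes by q(t) - q(t + 2k) for every [w]; the
    last summand is this constant, read off at w = 0. *)
Lemma energy_shift k w t :
  energy al be ga (vshift k w) (tshift k t) = energy al be ga w t
  + (energy al be ga (vshift k (0, 0)) (tshift k t)).
Proof.
rewrite /energy /zform /qform /vshift /tshift /= !intrD !intrM /=; ring.
Qed.

Lemma energy_opp w t :
  energy al be ga (vopp_if true w) (topp_if true t) = energy al be ga w t.
Proof. by rewrite /energy /zform /qform /= !intrN; ring. Qed.

Lemma is_min_shift c k t m : is_min al be ga c t m ->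
  is_min al be ga c (tshift k t) (m + energy al be ga (vshift k (0, 0)) (tshift k t)).
Proof.
have P k' w : parity (vshift k' w) = parity w by apply/parity_eqP; exists k'.
move=> [[w pw <-] mw]; split.
  by exists (vshift k w); [rewrite P | exact: energy_shift].
move=> v pv; have -> : v = vshift k (vshift (vopp_if true k) v).
  by case: v {pv} => x y; rewrite /vshift /=; congr pair; ring.
by rewrite [leRHS]energy_shift lerD2r; apply: mw; rewrite P.
Qed.

Lemma is_min_opp c t m : is_min al be ga c t m -> is_min al be ga c (topp_if true t) m.
Proof.
move=> [[w pw <-] mw]; split.
  by exists (vopp_if true w); [rewrite parity_vopp_if | exact: energy_opp].
move=> v pv; have -> : v = vopp_if true (vopp_if true v) by case: v {pv} => x y /=; rewrite !opprK.
by rewrite [leRHS]energy_opp; apply: mw; rewrite parity_vopp_if.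
Qed.

Lemma is_min_uniq c t m m' : is_min al be ga c t m -> is_min al be ga c t m' -> m = m'.
Proof.
by move=> [[w pw <-] mw] [[w' pw' <-] mw']; apply/le_anti; rewrite mw // mw'.
Qed.

(** The energy grows quadratically in [w], while the 0-1 representative has bounded energy. The box
    is uniform in [t], which makes theta a minimum of finitely many affine functions on a whole
    neighbourhood. *)
Lemma box_dominates (K : R) : exists B : nat, forall t w, `|t.1| <= K -> `|t.2| <= K ->
  exists2 w', w' \in box B & parity w' = parity w /\ energy al be ga w' t <= energy al be ga w t.
Proof.
(* A bound for the Selling form of any [w] that is no worse than the 0-1 representative: twice the
   sum of the bound [upper] and the negative part of the bound [low], with 2 K in place of K for the
   difference of coordinates. *)
pose M := 2 * (al * (1 + 2 * K + 2 * K ^+ 2) + be * (1 + 2 * K + 2 * K ^+ 2)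
  + ga * (1 + 4 * K + 8 * K ^+ 2)).
have [B HB] : exists B : nat, 1 + (`|M| / al + `|M| / be) <= B%:R.
  by exists (Num.truncn (1 + (`|M| / al + `|M| / be))).+1; rewrite ltW // truncnS_gt.
have Ma : 0 <= `|M| / al by rewrite divr_ge0 // ltW.
have Mb : 0 <= `|M| / be by rewrite divr_ge0 // ltW.
exists B => t w h1 h2.
have K0 : 0 <= K by apply: le_trans h1.
pose r : int * int := ((odd `|w.1|%N) : int, (odd `|w.2|%N) : int).
have rB : r \in box B.
  have B0 : (0 < B)%N by rewrite -(ltr_nat R); lra.
  have bB (o : bool) : `|(o : nat) : int| <= B%:Z by move: B0; clear; case: o; lia.
  by rewrite mem_box !bB.
have pr : parity r = parity w by rewrite /parity /r /= !oddb.
have upper (k x y z : R) : 0 < k -> 0 <= y -> `|x| <= 1 -> `|z| <= y ->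
    k * (x ^+ 2 - 2 * x * z) <= k * (1 + 2 * y).
  by move=> k0 y0; rewrite !ler_norml => x1 z1; rewrite ler_pM2l //; nra.
have low (k x y z : R) : 0 < k -> 0 <= y -> `|z| <= y ->
    k * (x ^+ 2 / 2 - 2 * y ^+ 2) <= k * (x ^+ 2 - 2 * x * z).
  move=> k0 y0; rewrite ler_norml => z1; rewrite ler_pM2l //.
  have : z ^+ 2 <= y ^+ 2 by nra.
  by have := sqr_ge0 (x - 2 * z); nra.
have h12 : `|t.1 - t.2| <= 2 * K by rewrite (le_trans (ler_normB _ _)) //; lra.
have EE (v : int * int) : energy al be ga v t = al * (v.1%:~R ^+ 2 - 2 * v.1%:~R * t.1)
   + be * (v.2%:~R ^+ 2 - 2 * v.2%:~R * t.2)
   + ga * ((v.1%:~R - v.2%:~R) ^+ 2 - 2 * (v.1%:~R - v.2%:~R) * (t.1 - t.2)).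
  by rewrite /energy /zform /qform; ring.
have [h|h] := leP (energy al be ga w t) (energy al be ga r t); last first.
  by exists r => //; split => //; exact: ltW.
exists w => //.
have up : energy al be ga r t <= al * (1 + 2 * K) + be * (1 + 2 * K) + ga * (1 + 2 * (2 * K)).
  rewrite EE /r /=; apply: lerD; [apply: lerD|]; apply: upper => //; try lra.
  - by case: (odd _); rewrite ?normr0 ?normr1 ?ler01.
  - by case: (odd _); rewrite ?normr0 ?normr1 ?ler01.
  - by case: (odd _); case: (odd _); rewrite ?subrr ?subr0 ?sub0r ?normrN ?normr0 ?normr1 ?ler01.
have lo1 := low _ w.1%:~R _ _ al0 K0 h1.
have lo2 := low _ w.2%:~R _ _ be0 K0 h2.
have K20 : 0 <= 2 * K by lra.
have lo3 := low _ (w.1%:~R - w.2%:~R) _ _ ga0 K20 h12.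
rewrite EE in h up.
have S : al * w.1%:~R ^+ 2 + be * w.2%:~R ^+ 2 + ga * (w.1%:~R - w.2%:~R) ^+ 2 <= M.
  move: (le_trans h up) lo1 lo2 lo3; rewrite /M; lra.
have S1 : 0 <= al * w.1%:~R ^+ 2 by rewrite mulr_ge0 ?sqr_ge0 // ltW.
have S2 : 0 <= be * w.2%:~R ^+ 2 by rewrite mulr_ge0 ?sqr_ge0 // ltW.
have S3 : 0 <= ga * (w.1%:~R - w.2%:~R) ^+ 2 by rewrite mulr_ge0 ?sqr_ge0 // ltW.
have SM := le_trans S (ler_norm M).
rewrite mem_box; apply/andP; split.
  apply: (@norm_int_le_sqr _ (`|M| / al)); first by lra.
  by rewrite ler_pdivlMr // mulrC; lra.
apply: (@norm_int_le_sqr _ (`|M| / be)); first by lra.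
by rewrite ler_pdivlMr // mulrC; lra.
Qed.

Lemma is_min_exists c t : exists m, is_min al be ga c t m.
Proof.
have [B HB] := box_dominates (`|t.1| + `|t.2|).
have D (w : int * int) : exists2 w', w' \in box B &
    parity w' = parity w /\ energy al be ga w' t <= energy al be ga w t.
  by apply: HB; rewrite ?lerDl ?lerDr.
pose s := [seq w <- box B | parity w == c].
have [w0 w0B [w0p _]] := D ((c.1 : nat) : int, (c.2 : nat) : int).
have s0 : s != [::].
  suff : w0 \in s by case: s.
  by rewrite mem_filter w0B w0p /parity /= !oddb -surjective_pairing eqxx.
have [|||w ws mw] := @preorder_min _ (fun x y => energy al be ga x t <= energy al be ga y t) s.
- by move=> x y z; apply: le_trans.
- by move=> x y _ _; apply/orP; exact: le_total.
- exact: s0.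
exists (energy al be ga w t); split.
  by exists w => //; move: ws; rewrite mem_filter => /andP[/eqP].
move=> v pv; have [w' w'B [pw' le']] := D v; apply: le_trans le'; apply: mw.
by rewrite mem_filter w'B pw' pv eqxx.
Qed.

End Positive.
End Minima.

(** * The complex of cells of a hyperplane arrangement *)

Section Arrangement.
Variables (R : realType) (n : nat) (I : finType).
Variables (l : I -> 'rV[int]_n) (h : I -> R).
Implicit Types (s : {ffun I -> option bool}) (x y a : 'rV[R]_n).

Let L i x : R := dotv (intvec R (l i)) x.

Lemma dotvDr a x y : dotv a (x + y) = dotv a x + dotv a y.
Proof. by rewrite /dotv linearD mulmxDr mxE. Qed.

Lemma dotvZr a k x : dotv a (k *: x) = k * dotv a x.
Proof. by rewrite /dotv linearZ /= -scalemxAr mxE. Qed.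

Lemma dotvDl a x y : dotv (x + y) a = dotv x a + dotv y a.
Proof. by rewrite /dotv mulmxDl mxE. Qed.

Lemma dotvZl a k x : dotv (k *: x) a = k * dotv x a.
Proof. by rewrite /dotv -scalemxAl mxE. Qed.

Lemma dotvBl a x y : dotv (x - y) a = dotv x a - dotv y a.
Proof. by rewrite /dotv mulmxBl !mxE. Qed.

Lemma dotv0l x : dotv 0 x = 0.
Proof. by rewrite /dotv mul0mx mxE. Qed.

(** The conditions are closed, so cells of different sign vectors meet along common faces; some
    cells may be empty or coincide. *)
Definition sign_cond (o : option bool) (u v : R) : bool :=
  match o with None => u == v | Some true => u <= v | Some false => v <= u end.

Definition cell s : set 'rV[R]_n := [set x | forall i, sign_cond (s i) (L i x) (h i)].

Lemma cell_cover x : exists s, cell s x.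
Proof.
by exists [ffun i => Some (L i x <= h i)] => i; rewrite ffunE /=; case: leP => // /ltW.
Qed.

Definition cell_constraints s : seq ('rV[int]_n * R) :=
  flatten [seq (if s i == Some false then [::] else [:: (l i, h i)]) ++
               (if s i == Some true then [::] else [:: (- l i, - h i)]) | i <- enum I].

Lemma cell_rational s : rat_polyhedron (cell s).
Proof.
exists (cell_constraints s); apply/seteqP; split=> x /= H.
  move=> p /flatten_mapP[i _]; have := H i; rewrite mem_cat.
  have N : dotv (intvec R (- l i)) x = - L i x.
    by rewrite -mulN1r -dotvZl; congr dotv; apply/rowP=> j; rewrite !mxE intrN mulN1r.
  case: (s i) => [[]|] /=; rewrite ?inE ?orbF.
  - by move=> ? /eqP->.
  - by move=> ? /eqP-> /=; rewrite N lerN2.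
  - by move=> /eqP E /orP[]/eqP-> /=; rewrite ?N -E.
move=> i.
have N : dotv (intvec R (- l i)) x = - L i x.
  by rewrite -mulN1r -dotvZl; congr dotv; apply/rowP=> j; rewrite !mxE intrN mulN1r.
have H1 : s i != Some false -> L i x <= h i.
  move=> e; apply: (H (l i, h i)); apply/flatten_mapP; exists i; first by rewrite mem_enum.
  by rewrite mem_cat (negbTE e) inE eqxx.
have H2 : s i != Some true -> h i <= L i x.
  move=> e; rewrite -lerN2 -N; apply: (H (- l i, - h i)); apply/flatten_mapP.
  by exists i; rewrite ?mem_enum // mem_cat (negbTE e) inE eqxx orbT.
move: H1 H2; case: (s i) => [[]|] /=.
- by move=> /(_ isT).
- by move=> _ /(_ isT).
- by move=> /(_ isT) u /(_ isT) v; apply/eqP/le_anti; rewrite u v.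
Qed.

Definition tighten s (J : pred I) : {ffun I -> option bool} :=
  [ffun i => if J i then None else s i].

Lemma cell_tighten s (J : pred I) x :
  cell (tighten s J) x <-> cell s x /\ forall i, J i -> L i x = h i.
Proof.
split=> [H|[H1 H2] i].
  split=> i; have := H i; rewrite ffunE.
    by case: (J i) => //= /eqP ->; case: (s i) => [[]|] /=.
  by move=> + Ji; rewrite Ji => /eqP.
by rewrite ffunE; case: ifP => [/H2 -> /=|_]; [rewrite eqxx|apply: H1].
Qed.

Lemma cell_convex s x y (k : R) : 0 <= k <= 1 -> cell s x -> cell s y ->
  cell s (k *: x + (1 - k) *: y).
Proof.
move=> /andP[k0 k1] hx hy i; have := hx i; have := hy i.
rewrite /L dotvDr !dotvZr -/(L i x) -/(L i y); case: (s i) => [[]|] /=; try by nra.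
Qed.

(** Run through the constraints: one that is not tight on all of [F] is made slack by averaging with
    a point of [F] where it is slack. A midpoint is tight only where both ends are. *)
Lemma relative_interior s (F : set 'rV[R]_n) (a : 'rV[R]_n) (c : R) :
  F = cell s `&` [set x | dotv a x = c] -> F !=set0 ->
  exists2 x, F x & forall i, L i x = h i -> forall y, F y -> L i y = h i.
Proof.
move=> FE [x0 Fx0].
suff [x Fx H] : exists2 x, F x & forall i, i \in enum I ->
    L i x = h i -> forall y, F y -> L i y = h i.
  by exists x => // i; apply: H; rewrite mem_enum.
elim: (enum I) => [|i r [x Fx IH]]; first by exists x0.
have [H|] := pselect (forall y, F y -> L i y = h i).
  by exists x => // j; rewrite inE => /predU1P[->//|]; apply: IH.
move=> /existsNP[y /not_implyP[Fy ny]].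
exists (2^-1 *: x + (1 - 2^-1) *: y).
  move: Fx Fy; rewrite FE => -[cx ax] [cy ay]; split; first by apply: cell_convex => //; lra.
  by rewrite /= dotvDr !dotvZr ax ay; ring.
have mid j : L j (2^-1 *: x + (1 - 2^-1) *: y) = h j -> L j x = h j /\ L j y = h j.
  rewrite /L dotvDr !dotvZr -!/(L _ _).
  have := Fx; have := Fy; rewrite FE => -[/(_ j) cy _] [/(_ j) cx _]; move: cx cy.
  by case: (s j) => [[]|] /=; try (by split; lra); move=> /eqP-> /eqP->.
move=> j; rewrite inE => /predU1P[->|jr] /mid[e1 e2] z Fz; first by case: ny.
exact: IH jr e1 z Fz.
Qed.

(** Tighten the constraints that are tight at a relative interior point x of [F]. For y in the
    resulting cell, the segment from y to x extends a little beyond x inside the original cell. The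
    functional [a] is maximal at x, so it cannot be smaller at y. *)
Lemma cell_face s F : face F (cell s) -> exists s', cell s' = F.
Proof.
move=> [F0 [a [c [H FE]]]]; have [x Fx Hx] := relative_interior FE F0.
exists (tighten s (fun i => L i x == h i)); rewrite FE; apply/seteqP; split=> y.
  move=> /cell_tighten[cy ty]; split=> //=; apply/le_anti; rewrite H //=.
  have [cx ax] : cell s x /\ dotv a x = c by move: Fx; rewrite FE.
  suff [e e0 ce] : exists2 e : R, 0 < e & cell s (x + e *: (x - y)).
    have := H _ ce; rewrite dotvDr dotvZr -[- y]scaleN1r dotvDr dotvZr ax.
    by move: (dotv a y) => u; nra.
  suff [e e0 ce] : exists2 e : R, 0 < e & forall e', 0 < e' <= e -> forall i, i \in enum I ->
      sign_cond (s i) (L i (x + e' *: (x - y))) (h i).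
    by exists e => // i; apply: ce; rewrite ?mem_enum // e0 lexx.
  elim: (enum I) => [|i r [e e0 IH]]; first by exists 1.
  suff [d d0 Hd] : exists2 d : R, 0 < d & forall e', 0 < e' <= d ->
      sign_cond (s i) (L i (x + e' *: (x - y))) (h i).
    exists (Order.min d e); first by rewrite lt_min d0.
    move=> e' /andP[p]; rewrite le_min => /andP[le1 le2] j; rewrite inE => /predU1P[->|jr].
      by apply: Hd; rewrite p.
    by apply: IH => //; rewrite p.
  have LE d : L i (x + d *: (x - y)) = L i x + d * (L i x - L i y).
    by rewrite /L dotvDr dotvZr -[- y]scaleN1r dotvDr dotvZr mulN1r.
  have [tx|ntx] := eqVneq (L i x) (h i).
    exists 1 => // d _; rewrite LE (ty i) ?tx // subrr mulr0 addr0.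
    by case: (s i) => [[]|] /=.
  (* A step of this length cannot use up the slack of the constraint at x; the summand 1 keeps the
     denominator positive. *)
  pose q := `|h i - L i x| / (1 + `|L i x - L i y|).
  have den : 0 < 1 + `|L i x - L i y| by rewrite ltr_pwDl.
  exists q; first by rewrite divr_gt0 // normr_gt0 subr_eq0 eq_sym.
  move=> d /andP[d0 dq]; rewrite LE.
  have B : `|d * (L i x - L i y)| <= `|h i - L i x|.
    rewrite normrM gtr0_norm //; move: dq; rewrite ler_pdivlMr // => dq.
    by apply: le_trans dq; rewrite ler_pM2l // lerDr.
  have := cx i; move: B; case: (s i) => [[]|] /=.
  - by move=> B u; move: B; rewrite [X in _ <= X]ger0_norm ?subr_ge0 // ler_norml; lra.
  - by move=> B u; move: B; rewrite [X in _ <= X]ler0_norm ?subr_le0 // ler_norml; lra.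
  - by move=> _ /eqP E; rewrite E eqxx in ntx.
move=> [cy ay]; apply/cell_tighten; split=> // i /eqP e; apply: (Hx i e).
by rewrite FE.
Qed.

(** The signed sum of the constraints in [J] is the exposing functional: the sum is tight only if
    every summand is. Equality constraints hold anyway and get sign 0. *)
Lemma face_tighten s (J : pred I) : cell (tighten s J) !=set0 ->
  face (cell (tighten s J)) (cell s).
Proof.
move=> ne; split=> //.
pose sg i : R := match s i with Some true => 1 | Some false => -1 | None => 0 end.
exists (\sum_(i | J i) sg i *: intvec R (l i)), (\sum_(i | J i) sg i * h i).
have D x : dotv (\sum_(i | J i) sg i *: intvec R (l i)) x = \sum_(i | J i) sg i * L i x.
  elim/big_rec2: _ => [|i u v _ E]; first by rewrite dotv0l.
  by rewrite dotvDl dotvZl E.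
have T i x : cell s x -> sg i * L i x <= sg i * h i.
  by move=> /(_ i); rewrite /sg; case: (s i) => [[]|] /=; lra.
split=> [x cx|]; first by rewrite D; apply: ler_sum => i _; apply: T.
apply/seteqP; split=> x.
  move=> /cell_tighten[cx tx]; split=> //=; rewrite D.
  by apply: eq_bigr => i /tx ->.
move=> [cx /=]; rewrite D => E; apply/cell_tighten; split=> // i Ji.
have /eqP : \sum_(i | J i) (sg i * h i - sg i * L i x) = 0 by rewrite sumrB E subrr.
rewrite psumr_eq0; last by move=> j _; rewrite subr_ge0 T.
move=> /allP/(_ i); rewrite mem_index_enum Ji /= => /(_ isT).
have := cx i; rewrite /sg; case: (s i) => [[]|] /= u.
- by rewrite !mul1r subr_eq0 eq_sym => /eqP.
- by rewrite !mulN1r subr_eq0 eqr_opp eq_sym => /eqP.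
- by move=> _; apply/eqP.
Qed.

Lemma tighten_diffC s s' :
  tighten s (fun i => s i != s' i) = tighten s' (fun i => s' i != s i).
Proof. by apply/ffunP=> i; rewrite !ffunE [s' i == _]eq_sym; case: eqP. Qed.

(** Two different sign conditions on the same hyperplane hold together exactly on the hyperplane. *)
Lemma cell_meet s s' :
  cell s `&` cell s' = cell (tighten s (fun i => s i != s' i)).
Proof.
apply/seteqP; split=> x.
  move=> [cx cx']; apply/cell_tighten; split=> // i; have := cx i; have := cx' i.
  case: (s i) (s' i) => [[]|] [[]|] //=; do ?[by move=> /eqP | by move=> _ /eqP].
  - by move=> u v _; apply/le_anti; rewrite u v.
  - by move=> u v _; apply/le_anti; rewrite u v.
move=> /[dup]; rewrite {2}tighten_diffC => /cell_tighten[cx _] /cell_tighten[cx' _].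
by [].
Qed.

Definition arrangement (k : 'I_#|{ffun I -> option bool}|) : set 'rV[R]_n :=
  cell (enum_val k).

Lemma arrangementE s : arrangement (enum_rank s) = cell s.
Proof. by rewrite /arrangement enum_rankK. Qed.

Lemma arrangement_complex : polyhedral_complex arrangement.
Proof.
split=> [i|i F /cell_face[s <-]|i j]; first exact: cell_rational.
  by exists (enum_rank s); rewrite arrangementE.
have [->|ne] := eqVneq (arrangement i `&` arrangement j) set0; first by left.
right; move: ne => /set0P; rewrite /arrangement; move: (enum_val i) (enum_val j) => s s' ne.
split; last rewrite setIC; rewrite cell_meet; apply: face_tighten.
  by rewrite -cell_meet.
by rewrite -cell_meet setIC.
Qed.

Lemma support_arrangement : Defs.support arrangement = setT.
Proof.
apply/seteqP; split=> // x _; have [s cx] := cell_cover x.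
by exists (enum_rank s); rewrite arrangementE.
Qed.

End Arrangement.

(** * Selling reduction *)

Section Selling.
Context {R : realType}.

Definition bform (p q r : R) (x y : int * int) : R :=
  p * x.1%:~R * y.1%:~R + q * (x.1%:~R * y.2%:~R + x.2%:~R * y.1%:~R)
  + r * x.2%:~R * y.2%:~R.

Definition zdet (x y : int * int) : int := x.1 * y.2 - x.2 * y.1.

Definition zadd (x y : int * int) : int * int := (x.1 + y.1, x.2 + y.2).

(* Minimising the sum of the norms of a superbase makes it obtuse: if B(h_i,h_j) > 0,
   the superbase -h_i, h_j, h_i - h_j has a sum of norms smaller by 4 B(h_i,h_j). *)
Lemma obtuse_superbase (p q r : R) : 0 < p -> 0 < p * r - q ^+ 2 ->
  exists h1 h2, [/\ `|zdet h1 h2| = 1, bform p q r h1 h2 <= 0,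
    0 <= bform p q r h1 (zadd h1 h2) & 0 <= bform p q r h2 (zadd h1 h2)].
Proof.
move=> p0 D0; set D := p * r - q ^+ 2 in D0.
have r0 : 0 < r by rewrite -(pmulr_rgt0 _ p0); have := sqr_ge0 q; rewrite /D in D0; lra.
pose N x := bform p q r x x.
have N1 x : x.1%:~R ^+ 2 <= r * N x / D.
  rewrite ler_pdivlMr // -subr_ge0.
  have -> : r * N x - x.1%:~R ^+ 2 * D = (q * x.1%:~R + r * x.2%:~R) ^+ 2.
    by rewrite /N /bform /D; ring.
  exact: sqr_ge0.
(* As for [N1], completing the square bounds a coordinate by the norm, so only finitely many
   integral vectors have norm at most [f id0]. *)
have N2 x : x.2%:~R ^+ 2 <= p * N x / D.
  rewrite ler_pdivlMr // -subr_ge0.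
  have -> : p * N x - x.2%:~R ^+ 2 * D = (p * x.1%:~R + q * x.2%:~R) ^+ 2.
    by rewrite /N /bform /D; ring.
  exact: sqr_ge0.
have N0 x : 0 <= N x.
  have := le_trans (sqr_ge0 _) (N1 x).
  by rewrite pmulr_lge0 ?invr_gt0 // pmulr_rge0.
pose f (h : (int * int) * (int * int)) := N h.1 + N h.2 + N (zadd h.1 h.2).
pose id0 : (int * int) * (int * int) := ((1, 0), (0, 1)).
have [B HB] : exists B : nat, 1 + (p + r) * f id0 / D <= B%:R.
  by exists (Num.truncn (1 + (p + r) * f id0 / D)).+1; rewrite ltW // truncnS_gt.
have f0 h : 0 <= f h by rewrite /f; apply: addr_ge0; [apply: addr_ge0|]; exact: N0.
have K0 : 0 <= (p + r) * f id0 / D.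
  by apply: mulr_ge0; [apply: mulr_ge0 => //; lra | rewrite invr_ge0 ltW].
have small x : N x <= f id0 -> x \in box B.
  move=> h; rewrite mem_box; apply/andP; split.
    apply: (@norm_int_le_sqr R _ ((p + r) * f id0 / D)); first lra.
    apply: (le_trans (N1 x)); rewrite ler_pM2r ?invr_gt0 // mulrDl.
    have := ler_wpM2l (ltW r0) h; have := mulr_ge0 (ltW p0) (f0 id0); lra.
  apply: (@norm_int_le_sqr R _ ((p + r) * f id0 / D)); first lra.
  apply: (le_trans (N2 x)); rewrite ler_pM2r ?invr_gt0 // mulrDl.
  have := ler_wpM2l (ltW p0) h; have := mulr_ge0 (ltW r0) (f0 id0); lra.
pose s := [seq h <- [seq (x, y) | x <- box B, y <- box B] | `|zdet h.1 h.2| == 1].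
have smem h : `|zdet h.1 h.2| = 1 -> f h <= f id0 -> h \in s.
  case: h => x y /= d le; have {}le : N x + N y + N (zadd x y) <= f id0 by [].
  rewrite mem_filter d eqxx andTb; apply/allpairsP; exists (x, y); split=> //=; apply: small.
    by have := N0 y; have := N0 (zadd x y); lra.
  by have := N0 x; have := N0 (zadd x y); lra.
have id0s : id0 \in s by apply: smem.
have [|||h hs mh] := @preorder_min _ (fun x y => f x <= f y) s.
- by move=> x y z; apply: le_trans.
- by move=> x y _ _; apply/orP; exact: le_total.
- by case: (s) id0s.
have dh : `|zdet h.1 h.2| = 1 by move: hs; rewrite mem_filter => /andP[/eqP].
have mh' h' : `|zdet h'.1 h'.2| = 1 -> f h <= f h'.
  move=> d; have [le|lt] := leP (f h') (f id0); first exact/mh/smem.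
  by apply: le_trans (ltW lt); apply: mh.
exists h.1, h.2; case: h dh mh' {hs mh} => [[a b] [c d]]; rewrite /zdet /= => dh mh'.
split=> //.
(* The superbase is h1, h2, -(h1 + h2), and each competitor treats one of its three pairs. The last
   two inequalities are reversed because [zadd h1 h2] is minus the third vector. *)
- have := mh' ((- a, - b), (c, d)); rewrite /f /N /bform /zadd /= !intrD !intrN => H.
  by have := H (ltac:(lia)); lra.
- have := mh' ((- a, - b), (- a - c, - b - d)).
  rewrite /f /N /bform /zadd /= !(intrD, intrN) => H.
  by have := H (ltac:(lia)); lra.
- have := mh' ((- c, - d), (- a - c, - b - d)).
  rewrite /f /N /bform /zadd /= !(intrD, intrN) => H.
  by have := H (ltac:(lia)); lra.
Qed.

(** * Integral matrices and Gram matrices of bases *)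

Lemma sum_ord2 (V : nmodType) (F : 'I_2 -> V) : \sum_i F i = F 0 + F 1.
Proof.
rewrite !big_ord_recl big_ord0 addr0; congr (_ + F _); exact: val_inj.
Qed.

Lemma intmxM m n k (A : 'M[int]_(m, n)) (B : 'M[int]_(n, k)) :
  intmx R (A *m B) = intmx R A *m intmx R B.
Proof. by rewrite /intmx map_mxM. Qed.

Lemma intvecM n k (z : 'rV[int]_n) (B : 'M[int]_(n, k)) :
  intvec R (z *m B) = intvec R z *m intmx R B.
Proof. exact: intmxM. Qed.

Lemma intmx1 n : intmx R (1%:M : 'M[int]_n) = 1%:M.
Proof. by rewrite /intmx map_mx1. Qed.

Lemma intvecD n (z z' : 'rV[int]_n) : intvec R (z + z') = intvec R z + intvec R z'.
Proof. by rewrite /intvec map_mxD. Qed.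

Lemma intvecB n (z z' : 'rV[int]_n) : intvec R (z - z') = intvec R z - intvec R z'.
Proof. by rewrite /intvec map_mxB. Qed.

Lemma intvecN n (z : 'rV[int]_n) : intvec R (- z) = - intvec R z.
Proof. by rewrite /intvec map_mxN. Qed.

Lemma intvec_inj n : injective (@intvec R n).
Proof. by move=> z z' /rowP h; apply/rowP=> i; have := h i; rewrite !mxE => /intr_inj. Qed.

Lemma intmx_unit n (H : 'M[int]_n) : H \in unitmx -> intmx R H \in unitmx.
Proof.
move=> Hu; have E : intmx R H *m intmx R (invmx H) = 1%:M by rewrite -intmxM mulmxV ?intmx1.
by have [] := mulmx1_unit E.
Qed.

Lemma intmx_inv n (H : 'M[int]_n) : H \in unitmx -> intmx R (invmx H) = invmx (intmx R H).
Proof.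
move=> Hu; rewrite -[LHS]mul1mx -[in LHS](mulVmx (intmx_unit Hu)) -mulmxA -intmxM.
by rewrite mulmxV // intmx1 mulmx1.
Qed.

Lemma ord2P (i : 'I_2) : i = 0 \/ i = 1.
Proof. by case: i => [[|[|]]] // H; [left|right]; apply: val_inj. Qed.

Lemma matrix2P (T : Type) (A B : 'M[T]_2) :
  A 0 0 = B 0 0 -> A 0 1 = B 0 1 -> A 1 0 = B 1 0 -> A 1 1 = B 1 1 -> A = B.
Proof.
by move=> ????; apply/matrixP=> i j; case: (ord2P i) => ->; case: (ord2P j) => ->.
Qed.

Definition mx22 (T : Type) (x y : T * T) : 'M[T]_2 :=
  \matrix_(i, j) (let w := if i == 0 then x else y in if j == 0 then w.1 else w.2).

Lemma mx22_unit h1 h2 : `|zdet h1 h2| = 1 -> mx22 h1 h2 \in unitmx.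
Proof.
move=> d; rewrite unitmxE /=.
have -> : \det (mx22 h1 h2) = zdet h1 h2.
  rewrite (expand_det_row _ 0) sum_ord2 /cofactor !det_mx11 !mxE /= /zdet.
  by rewrite expr0 expr1 mul1r mulN1r mulrN.
have : zdet h1 h2 = 1 \/ zdet h1 h2 = -1 by lia.
by move=> [->|->]; rewrite ?unitrN unitr1.
Qed.

Lemma gram_entries (P : 'M[R]_2) h1 h2 : P^T = P ->
  let G := intmx R (mx22 h1 h2) *m P *m (intmx R (mx22 h1 h2))^T in
  let B := bform (P 0 0) (P 0 1) (P 1 1) in
  [/\ G 0 0 = B h1 h1, G 0 1 = B h1 h2, G 1 0 = B h1 h2 & G 1 1 = B h2 h2].
Proof.
move=> sP /=; have P10 : P 1 0 = P 0 1 by rewrite -[in LHS]sP mxE.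
by rewrite /bform !mxE !sum_ord2 !mxE !sum_ord2 !mxE P10 /=; split; ring.
Qed.

(** * Irreducibility and positivity of the Selling parameters *)

Section Posdef.
Variables (M' : set 'rV[R]_2) (Q : 'M[R]_2).
Hypotheses (sQ : Q^T = Q) (posQ : forall x : 'rV[R]_2, x != 0 -> 0 < bil Q x x).

Lemma posdef_unit : Q \in unitmx.
Proof.
rewrite unitmxE unitfE; apply/negP=> /det0P[v v0 vQ].
by have := posQ v0; rewrite /bil vQ mul0mx mxE ltxx.
Qed.

Lemma invmx_sym : (invmx Q)^T = invmx Q.
Proof. by rewrite trmx_inv sQ. Qed.

Lemma invmx_posdef (x : 'rV[R]_2) : x != 0 -> 0 < bil (invmx Q) x x.
Proof.
move=> x0; have Qu := posdef_unit.
have -> : bil (invmx Q) x x = bil Q (x *m invmx Q) (x *m invmx Q).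
  by rewrite /bil trmx_mul invmx_sym mulmxA mulmxKV.
apply: posQ; apply: contraNneq x0 => E.
by rewrite -[x](mulmxKV Qu) E mul0mx.
Qed.

Lemma invmx_minors : let P := invmx Q in
  0 < P 0 0 /\ 0 < P 0 0 * P 1 1 - P 0 1 ^+ 2.
Proof.
move=> P; have P10 : P 1 0 = P 0 1.
  by have := congr1 (fun A : 'M[R]_2 => A 0 1) invmx_sym; rewrite mxE.
have E (a b : R) : bil P (pair2 a b) (pair2 a b) =
    P 0 0 * a ^+ 2 + 2 * P 0 1 * a * b + P 1 1 * b ^+ 2.
  by rewrite /bil !mxE !sum_ord2 !mxE !sum_ord2 !mxE P10 /=; ring.
have nz (a b : R) : (a != 0) || (b != 0) -> pair2 a b != 0.
  move=> /orP[] h; apply: contraNneq h => e.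
    by have := congr1 (fun M : 'rV[R]_2 => M 0 0) e; rewrite !mxE /= => ->.
  by have := congr1 (fun M : 'rV[R]_2 => M 0 1) e; rewrite !mxE /= => ->.
have p0 : 0 < P 0 0.
  have := invmx_posdef (nz 1 0 _); rewrite oner_neq0 => /(_ isT).
  by rewrite E expr1n expr0n /= !mulr0 !addr0 mulr1.
(* At this vector the form takes the value [P 0 0] times the determinant. *)
split=> //; have := invmx_posdef (nz (- P 0 1) (P 0 0) _); rewrite (gt_eqF p0) orbT => /(_ isT).
by rewrite E => h; rewrite -(pmulr_rgt0 _ p0); lra.
Qed.

Hypothesis (latM : forall u, M' u <-> Nlat 2 (u *m Q)).

(** The isomorphism is x -> (<h1,x>, <h2,x>). It carries M' to the lattice of the Gram matrix
    diag(al, be) of Q^-1 and Q to the inverse diagonal form, so the factors are circles of lengths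
    al and be with q r = 1. *)
Lemma product_type_of_orthogonal h1 h2 : `|zdet h1 h2| = 1 ->
  bform (invmx Q 0 0) (invmx Q 0 1) (invmx Q 1 1) h1 h2 = 0 -> product_type M' Q.
Proof.
move=> d o; set H := mx22 h1 h2; have Hu : H \in unitmx := mx22_unit d.
have Qu := posdef_unit; set Hr := intmx R H; have Hru : Hr \in unitmx := intmx_unit Hu.
have [g00 g01 g10 g11] := gram_entries h1 h2 invmx_sym.
rewrite -/H -/Hr o in g00 g01 g10 g11.
set al := bform _ _ _ h1 h1 in g00; set be := bform _ _ _ h2 h2 in g11.
have G : Hr *m invmx Q *m Hr^T = diag_mx (pair2 al be).
  by apply: matrix2P; rewrite ?(g00, g01, g10, g11) !mxE.
have pos (i : 'I_2) : 0 < (Hr *m invmx Q *m Hr^T) i i.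
  have -> : (Hr *m invmx Q *m Hr^T) i i = bil (invmx Q) (row i Hr) (row i Hr).
    by rewrite /bil -row_mul tr_row !mxE; apply: eq_bigr => k _; rewrite !mxE.
  apply: invmx_posdef; apply/negP=> /eqP e.
  have : row i (Hr *m invmx Hr) = 0 by rewrite row_mul e mul0mx.
  rewrite mulmxV // => /rowP/(_ i); rewrite !mxE eqxx => /eqP.
  by rewrite oner_eq0.
have al0 : 0 < al by rewrite -g00.
have be0 : 0 < be by rewrite -g11.
exists al, al^-1, be, be^-1, H^T; split.
- split; [by rewrite gt_eqF | split; [by rewrite invr_gt0 |]].
  by exists 1; rewrite mulVf // gt_eqF.
- split; [by rewrite gt_eqF | split; [by rewrite invr_gt0 |]].
  by exists 1; rewrite mulVf // gt_eqF.
- by rewrite unitmx_tr.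
- have HrT : intmx R H^T = Hr^T by rewrite /Hr /intmx map_trmx.
  move=> u; rewrite HrT -G latM; split=> -[z e].
    exists (z *m invmx H); rewrite intvecM intmx_inv // -e -!mulmxA mulKmx //.
    by rewrite mulKVmx.
  exists (z *m H); rewrite intvecM -/Hr.
  have : u *m Hr^T *m invmx Hr^T = intvec R z *m Hr *m invmx Q.
    by rewrite e !mulmxA mulmxK ?unitmx_tr.
  by rewrite mulmxK ?unitmx_tr // => ->; rewrite mulmxKV.
- have HrT : intmx R H^T = Hr^T by rewrite /Hr /intmx map_trmx.
  move=> x y; rewrite HrT /bil trmx_mul trmxK; congr (_ 0 0 : R).
  rewrite !mulmxA; congr (_ *m _); rewrite -!mulmxA; congr (_ *m _).
  set D := diag_mx _; have GG : D *m (Hr *m invmx Q *m Hr^T) = 1%:M.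
    by rewrite G mulmx_diag; apply: matrix2P; rewrite !mxE //= mulVf // gt_eqF.
  have E : D *m Hr *m invmx Q = invmx Hr^T.
    by rewrite -[RHS]mul1mx -GG !mulmxA mulmxK ?unitmx_tr.
  rewrite -[LHS](mulmxKV Qu) -!mulmxA.
  have -> : D *m (Hr *m (invmx Q *m Q)) = invmx Hr^T *m Q by rewrite -E !mulmxA.
  by rewrite mulKVmx ?unitmx_tr.
Qed.

Definition selling_gram (al be ga : R) : 'M[R]_2 :=
  mx22 (al + ga, - ga) (- ga, be + ga).

(** The parameters are the products of pairs in an obtuse superbase, up to sign. Any two of its
    vectors form a basis, so a vanishing product would split the surface. *)
Lemma selling_form : ~ product_type M' Q -> exists (H : 'M[int]_2) (al be ga : R),
  [/\ H \in unitmx, 0 < al, 0 < be, 0 < ga &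
      intmx R H *m invmx Q *m (intmx R H)^T = selling_gram al be ga].
Proof.
move=> irr; have [p0 D0] := invmx_minors.
have [h1 [h2 [d o12 o1 o2]]] := obtuse_superbase p0 D0.
have [g00 g01 g10 g11] := gram_entries h1 h2 invmx_sym.
set B := bform _ _ _ in g00 g01 g10 g11 o12 o1 o2 *.
have n h h' : `|zdet h h'| = 1 -> B h h' != 0.
  by move=> d'; apply/negP=> /eqP /(product_type_of_orthogonal d')/irr.
have d1 : `|zdet h1 (zadd h1 h2)| = 1 by rewrite -d /zdet /=; congr `|_|; ring.
have d2 : `|zdet h2 (zadd h1 h2)| = 1.
  by rewrite -d /zdet -[RHS]normrN /=; congr `|_|; ring.
exists (mx22 h1 h2), (B h1 (zadd h1 h2)), (B h2 (zadd h1 h2)), (- B h1 h2); split.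
- exact: mx22_unit.
- by rewrite lt_neqAle eq_sym n.
- by rewrite lt_neqAle eq_sym n.
- by rewrite oppr_gt0 lt_neqAle n.
- apply: matrix2P; rewrite ?(g00, g01, g10, g11) !mxE /= ?opprK // /B /bform /zadd /=;
    by rewrite !intrD; ring.
Qed.

End Posdef.
End Selling.

(** * Theta functions *)

(** [D] followed by the inverse of [A *m D] is a retraction of [A], so the image of [A] is a direct
    summand. *)
Lemma unimodular_lin_of_unit n m (A : 'M[int]_(n, m)) (D : 'M[int]_(m, n)) :
  A *m D \in unitmx -> unimodular_lin A.
Proof.
move=> u; split=> [z zA|y k k0 [z e]].
  by rewrite -[z](mulmxK u) mulmxA zA !mul0mx.
exists (y *m D *m invmx (A *m D)).
have ez : z = k *: (y *m D *m invmx (A *m D)).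
  by rewrite -[z](mulmxK u) mulmxA -e !scalemxAl.
have : k *: y = k *: (y *m D *m invmx (A *m D) *m A) by rewrite e {1}ez [RHS]scalemxAl.
by move=> /matrixP E; apply/matrixP=> i j; have := E i j; rewrite !mxE => /(mulfI k0).
Qed.

Lemma inf_min (R : realType) (E : set R) (m : R) : E m -> (forall y, E y -> m <= y) -> inf E = m.
Proof.
move=> Em lb; apply/le_anti/andP; split.
  by apply: ge_inf => //; exists m.
by apply: lb_le_inf => //; exists m.
Qed.

Definition ivec (w : int * int) : 'rV[int]_2 := \row_i (if i == 0 then w.1 else w.2).
Definition ipair (z : 'rV[int]_2) : int * int := (z 0 0, z 0 1).

Lemma ivecK : cancel ivec ipair.
Proof. by case=> x y; rewrite /ipair !mxE. Qed.

Lemma row2P (T : Type) (u v : 'rV[T]_2) : u 0 0 = v 0 0 -> u 0 1 = v 0 1 -> u = v.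
Proof. by move=> ? ?; apply/rowP=> i; case: (ord2P i) => ->. Qed.

Lemma ipairK : cancel ipair ivec.
Proof. by move=> z; apply: row2P; rewrite !mxE. Qed.

Lemma ivec_vshift k w : ivec (vshift k w) = ivec k *+ 2 + ivec w.
Proof. by apply: row2P; rewrite !mxE /=; ring. Qed.

Lemma ivec_vsub w v : ivec (vsub w v) = ivec w - ivec v.
Proof. by apply: row2P; rewrite !mxE. Qed.

Section Theta.
Context {R : realType}.
Variables (M' : set 'rV[R]_2) (Q : 'M[R]_2) (H : 'M[int]_2) (al be ga : R).
Hypotheses (sQ : Q^T = Q) (Qu : Q \in unitmx).
Hypothesis (latM : forall u, M' u <-> Nlat 2 (u *m Q)).
Hypotheses (Hu : H \in unitmx) (al0 : 0 < al) (be0 : 0 < be) (ga0 : 0 < ga).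
Hypothesis gramE : intmx R H *m invmx Q *m (intmx R H)^T = selling_gram al be ga.

Let Hr := intmx R H.
Let Hru : Hr \in unitmx := intmx_unit Hu.
Let E := energy al be ga.

(** The factor -2 turns q(w) + 4 <wH, x> into the energy of [w] at t, and carries M' to 2 Z^2. *)
Definition coord_mx : 'M[R]_2 := (-2) *: (Q *m invmx Hr).
Definition coords (x : 'rV[R]_2) : R * R := ((x *m coord_mx) 0 0, (x *m coord_mx) 0 1).

Lemma coordsD x y : coords (x + y) = ((coords x).1 + (coords y).1, (coords x).2 + (coords y).2).
Proof. by rewrite /coords mulmxDl /=; congr pair; rewrite [LHS]mxE. Qed.

Lemma coordsN x : coords (- x) = topp_if true (coords x).
Proof. by rewrite /coords mulNmx /=; congr pair; rewrite [LHS]mxE. Qed.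

Lemma coords_inj : injective coords.
Proof.
move=> x y [h1 h2]; have e : x *m coord_mx = y *m coord_mx by exact: row2P.
move: e; rewrite /coord_mx -!scalemxAr => /(scalerI _) e.
have {}e : x *m (Q *m invmx Hr) = y *m (Q *m invmx Hr) by apply: e; rewrite oppr_eq0 pnatr_eq0.
by move: e; rewrite !mulmxA => /(can_inj (mulmxKV Hru))/(can_inj (mulmxK Qu)).
Qed.

Definition period (k : int * int) : 'rV[R]_2 := - intvec R (ivec k *m H) *m invmx Q.

Lemma period_lattice k : M' (period k).
Proof.
by apply/latM; exists (- (ivec k *m H)); rewrite /period mulmxKV // intvecN.
Qed.

Lemma lattice_period u : M' u -> exists k, u = period k.
Proof.
move=> /latM[z e]; exists (ipair (- z *m invmx H)); rewrite /period ipairK mulmxKV //.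
by rewrite intvecN opprK -e mulmxK.
Qed.

Lemma coords_period x k : coords (x + period k) = tshift k (coords x).
Proof.
rewrite coordsD /tshift; congr (_ + _, _ + _).
  rewrite /coords /period /coord_mx -scalemxAr !mulNmx mulmxA mulmxKV // intvecM mulmxK //=.
  by rewrite !mxE; ring.
rewrite /coords /period /coord_mx -scalemxAr !mulNmx mulmxA mulmxKV // intvecM mulmxK //=.
by rewrite !mxE; ring.
Qed.

Lemma zformE w : zform al be ga w = bil (invmx Q) (intvec R (ivec w *m H)) (intvec R (ivec w *m H)).
Proof.
rewrite /bil intvecM trmx_mul -!mulmxA [X in _ *m X]mulmxA [X in _ *m X]mulmxA gramE.
by rewrite /zform /qform /selling_gram !(mxE, sum_ord2) /=; ring.
Qed.

Lemma energyE w x :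
  E w (coords x) = 4 * dotv (intvec R (ivec w *m H)) x + zform al be ga w.
Proof.
have xH : x *m Hr^T = (- 2^-1) *: ((x *m coord_mx) *m selling_gram al be ga).
  rewrite -gramE /coord_mx -!scalemxAr -!scalemxAl scalerA !mulmxA mulmxKV // mulmxK //.
  by rewrite mulrNN mulVf ?scale1r // pnatr_eq0.
have -> : dotv (intvec R (ivec w *m H)) x = (intvec R (ivec w) *m (x *m Hr^T)^T) 0 0.
  by rewrite /dotv intvecM trmx_mul trmxK mulmxA.
rewrite xH /E /energy /coords; move: (x *m coord_mx) => y.
by rewrite !(mxE, sum_ord2) /=; field.
Qed.

(** With v = 2 z + b one has u + c = v Q^-1 / 2, so the theta term is <v, x> + Q^-1(v, v) / 4. *)
Lemma theta_term_energy (b z : 'rV[int]_2) x u : u *m Q = intvec R z ->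
  theta_term Q (intvec R b) x u = E (ipair ((z *+ 2 + b) *m invmx H)) (coords x) / 4.
Proof.
move=> e; rewrite energyE zformE ipairK mulmxKV // mulrDl mulrAC divff ?pnatr_eq0 // mul1r.
set v := intvec R (_ + _).
have uc : u + 2^-1 *: (intvec R b *m invmx Q) = 2^-1 *: (v *m invmx Q).
  rewrite -[u in LHS](mulmxK Qu) e scalemxAl -mulmxDl scalemxAl; congr (_ *m _).
  by apply/rowP=> i; rewrite /v !mxE !intrD; field.
rewrite /theta_term uc /bil !linearZ /= -!scalemxAl.
have sc (k : R) (A : 'M[R]_1) : (k *: A) 0 0 = k * A 0 0 by rewrite mxE.
rewrite trmx_mul trmx_inv sQ !mulmxA mulmxK // mulmxKV // !sc.
rewrite /dotv.
have -> : (x *m v^T) 0 0 = (v *m x^T) 0 0.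
  by rewrite -[x *m _]trmxK trmx_mul trmxK mxE.
by field.
Qed.

Definition class_of (b : 'rV[int]_2) : bool * bool := parity (ipair (b *m invmx H)).

Lemma class_of_shift z b : class_of (z *+ 2 + b) = class_of b.
Proof.
apply/parity_eqP; exists (ipair (z *m invmx H)); apply: (can_inj ivecK).
by rewrite ivec_vshift !ipairK !mulr2n !mulmxDl.
Qed.

Lemma class_of_eq b b' : class_of b = class_of b' -> exists z, b = z *+ 2 + b'.
Proof.
move=> /parity_eqP[k /(congr1 ivec)]; rewrite ivec_vshift !ipairK => e.
exists (ivec k *m H); rewrite -[LHS](mulmxKV Hu) e !mulr2n !mulmxDl mulmxKV //.
Qed.

Lemma class_of_ivec w : class_of (ivec w *m H) = parity w.
Proof. by rewrite /class_of mulmxK // ivecK. Qed.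

Lemma theta_attained (b : 'rV[int]_2) x : exists u, M' u /\
  theta M' Q (intvec R b) x = theta_term Q (intvec R b) x u /\
  forall v, M' v -> theta_term Q (intvec R b) x u <= theta_term Q (intvec R b) x v.
Proof.
have [m [[w pw <-] mw]] := is_min_exists al0 be0 ga0 (class_of b) (coords x).
have [z ez] : exists z, ivec w *m H = z *+ 2 + b.
  by apply: class_of_eq; rewrite class_of_ivec.
have eu : intvec R z *m invmx Q *m Q = intvec R z by rewrite mulmxKV.
exists (intvec R z *m invmx Q); set u := _ *m invmx Q in eu *.
have Mu : M' u by apply/latM; exists z.
have min_u v : M' v -> theta_term Q (intvec R b) x u <= theta_term Q (intvec R b) x v.
  move=> /latM[z' e']; rewrite (theta_term_energy _ _ eu) (theta_term_energy _ _ e').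
  rewrite -ez mulmxK // ivecK ler_pM2r ?invr_gt0 ?ltr0n //; apply: mw.
  by rewrite -[LHS]/(class_of _) class_of_shift.
split=> //; split=> //; apply: inf_min; first by exists u.
by move=> _ [v Mv <-]; exact: min_u.
Qed.

Lemma theta_is_min (b : 'rV[int]_2) x :
  is_min al be ga (class_of b) (coords x) (4 * theta M' Q (intvec R b) x).
Proof.
have [u [Mu [-> min_u]]] := theta_attained b x; have /latM[z e] := Mu.
rewrite (theta_term_energy _ _ e) mulrC mulfVK ?pnatr_eq0 //; split.
  by exists (ipair ((z *+ 2 + b) *m invmx H)); rewrite -?[LHS]/(class_of _) ?class_of_shift.
move=> w pw; have [z' ez'] : exists z, ivec w *m H = z *+ 2 + b.
  by apply: class_of_eq; rewrite class_of_ivec.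
have eu : intvec R z' *m invmx Q *m Q = intvec R z' by rewrite mulmxKV.
have := min_u (intvec R z' *m invmx Q).
rewrite (theta_term_energy _ _ e) (theta_term_energy _ _ eu).
rewrite -ez' [ivec w *m H *m _]mulmxK // ivecK ler_pM2r ?invr_gt0 ?ltr0n //.
by apply; apply/latM; exists z'.
Qed.

Lemma coords_open (K : R) : open [set x | `|(coords x).1| < K /\ `|(coords x).2| < K].
Proof.
have lin i k : continuous (fun y : 'rV[R]_2 => y 0 i * k).
  move=> x; apply: (@continuousM R _ (fun y : 'rV[R]_2 => y 0 i) (fun=> k) x).
    exact: coord_continuous.
  exact: cst_continuous.
have cont j : continuous (fun x : 'rV[R]_2 => (x *m coord_mx) 0 j).
  have -> : (fun x : 'rV[R]_2 => (x *m coord_mx) 0 j) =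
     (fun x => x 0 0 * coord_mx 0 j + x 0 1 * coord_mx 1 j).
    by apply/funext=> y; rewrite mxE sum_ord2.
  move=> x; exact: (@continuousD R _ _ (fun y : 'rV[R]_2 => y 0 0 * coord_mx 0 j)
    (fun y : 'rV[R]_2 => y 0 1 * coord_mx 1 j) x (@lin _ _ _) (@lin _ _ _)).
have op j : open [set x : 'rV[R]_2 | `|(x *m coord_mx) 0 j| < K].
  apply: (@open_comp _ _ (fun x : 'rV[R]_2 => `|(x *m coord_mx) 0 j|) [set y | y < K]).
    move=> x _; apply: (@continuous_comp _ _ _ (fun x : 'rV[R]_2 => (x *m coord_mx) 0 j) Num.norm).
      exact: cont.
    exact: norm_continuous.
  exact: open_lt.
exact: openI (op 0) (op 1).
Qed.


Lemma theta_linear (b : 'rV[int]_2) x w : parity w = class_of b ->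
  (forall v, parity v = class_of b -> E w (coords x) <= E v (coords x)) ->
  theta M' Q (intvec R b) x = dotv (intvec R (ivec w *m H)) x + zform al be ga w / 4.
Proof.
move=> pw mw; have := is_min_uniq (theta_is_min b x) (conj (ex_intro2 _ _ w pw erefl) mw).
move=> e; have := energyE w x; rewrite /E; lra.
Qed.

(** Near [p] only vectors of a finite box compete. The lines on which two of them have equal energy
    cut the plane into cells with one fixed minimizer per class, so psi is affine on each cell. The
    linear part is unimodular by [minimizers_unimodular]. *)
Lemma unimodular_psi (b : 'I_4 -> 'rV[int]_2) : (forall c, exists i, class_of (b i) = c) ->
  unimodular setT (psi_map M' Q (fun i => intvec R (b i))).
Proof.
move=> /choice[g gP] p _.
pose K := 1 + `|(coords p).1| + `|(coords p).2|.
have [B HB] := box_dominates al0 be0 ga0 K.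
pose I : finType := (seq_sub (box B) * seq_sub (box B))%type.
pose l (i : I) : 'rV[int]_2 := ivec (vsub (val i.1) (val i.2)) *m H.
pose h (i : I) : R := (zform al be ga (val i.2) - zform al be ga (val i.1)) / 4.
pose U' : set 'rV[R]_2 := [set x | `|(coords x).1| < K /\ `|(coords x).2| < K].
have oU : open U' := @coords_open K.
have compare x (i : I) : dotv (intvec R (l i)) x - h i =
    (E (val i.1) (coords x) - E (val i.2) (coords x)) / 4.
  rewrite !energyE /h /l ivec_vsub mulmxBl intvecB dotvBl.
  by field.
exists U', _, (arrangement l h); split.
- split=> //; rewrite /U' /= /K.
  by have := normr_ge0 (coords p).1; have := normr_ge0 (coords p).2; split; lra.
- exact: arrangement_complex.
- by exists U'; rewrite support_arrangement setIT.
move=> k q Cq Uq.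
(* Every pair of box vectors contributes a line, and the cell lies on one side of it, so the
   comparison is total on the box. *)
pose le a b := forall x, arrangement l h k x -> E a (coords x) <= E b (coords x).
have tot : {in box B &, forall a b, le a b \/ le b a}.
  move=> a c ha hc; pose i : I := (SeqSub ha, SeqSub hc).
  have cmp x : arrangement l h k x -> sign_cond (enum_val k i) (dotv (intvec R (l i)) x) (h i).
    exact.
  have D x : E a (coords x) - E c (coords x) = 4 * (dotv (intvec R (l i)) x - h i).
    by rewrite compare /=; field.
  case: (enum_val k i) cmp => [[]|] /= cmp.
  - by left=> x /cmp; have := D x; lra.
  - by right=> x /cmp; have := D x; lra.
  - by left=> x /cmp/eqP; have := D x; lra.
have trans a c d : le a c -> le c d -> le a d.
  by move=> h1 h2 x Cx; apply: le_trans (h1 x Cx) (h2 x Cx).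
have minw c : exists w, [/\ w \in box B, parity w = c &
    forall v, v \in box B -> parity v = c -> le w v].
  pose s := [seq w <- box B | parity w == c].
  have [w0 w0B [w0p _]] := HB (coords q) ((c.1 : nat) : int, (c.2 : nat) : int)
    (ltW Uq.1) (ltW Uq.2).
  have s0 : s != [::].
    suff : w0 \in s by case: s.
    by rewrite mem_filter w0B w0p /parity /= !oddb -surjective_pairing eqxx.
  have [|w ws mw] := preorder_min trans _ s0.
    by move=> x y; rewrite !mem_filter => /andP[_ ?] /andP[_ ?]; apply: tot.
  move: ws; rewrite mem_filter => /andP[/eqP pw wB]; exists w; split=> // v vB pv.
  by apply: mw; rewrite mem_filter vB pv eqxx.
have [w wP] := choice minw.
have wmin x c v : arrangement l h k x -> U' x -> parity v = c ->
    E (w c) (coords x) <= E v (coords x).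
  move=> Cx Ux pv; have [v' v'B [pv' le']] := HB (coords x) v (ltW Ux.1) (ltW Ux.2).
  by apply: le_trans le'; have [_ _] := wP c; apply=> //; rewrite pv'.
pose W i := w (class_of (b i)).
exists setT; split; [exact: openT | by [] |].
exists (\matrix_(i, j) ((ivec (W (lift ord0 j)) - ivec (W ord0)) *m H) 0 i).
exists (\row_j (zform al be ga (W (lift ord0 j)) / 4 - zform al be ga (W ord0) / 4)).
split; last first.
  move=> x Cx Ux _; apply/rowP=> j; rewrite !mxE.
  have T i : theta M' Q (intvec R (b i)) x =
      dotv (intvec R (ivec (W i) *m H)) x + zform al be ga (W i) / 4.
    by apply: theta_linear; [have [_ ->] := wP (class_of (b i)) | move=> v; exact: wmin].
  rewrite !T.
  have -> : \sum_j0 x 0 j0 * (intmx R (\matrix_(i, j1)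
     ((ivec (W (lift ord0 j1)) - ivec (W ord0)) *m H) 0 i)) j0 j =
     dotv (intvec R ((ivec (W (lift ord0 j)) - ivec (W ord0)) *m H)) x.
    by rewrite [RHS]mxE; apply: eq_bigr => i _; rewrite mulrC !mxE.
  rewrite mulmxBl intvecB dotvBl; ring.
have [||c0 [c1 [c2 D]]] := minimizers_unimodular al0 be0 ga0 (t := coords q) (w := w).
- by move=> c; have [_ ->] := wP c.
- by move=> c v; exact: wmin.
(* Differences of these indicators select the columns of the linear part that combine to (w c1 - w
   c0) H and (w c2 - w c0) H. Index 0 has no column, which is harmless because its entry W 0 - W 0
   is zero. *)
pose d i c : int := ((lift ord0 i == g c) : nat)%:R.
apply: (@unimodular_lin_of_unit _ _ _
  (\matrix_(i, j) (if j == 0 then d i c1 - d i c0 else d i c2 - d i c0))).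
have sel (F : 'I_4 -> int) c : F ord0 = 0 -> \sum_(i < 3) F (lift ord0 i) * d i c = F (g c).
  move=> F0; transitivity (\sum_(i < 4) F i * ((i == g c) : nat)%:R).
    by rewrite [RHS]big_ord_recl F0 mul0r add0r.
  rewrite (bigD1 (g c)) //= eqxx mulr1 big1 ?addr0 // => i /negbTE->.
  by rewrite mulr0.
have Wg c : W (g c) = w c by rewrite /W gP.
have -> : (\matrix_(i, j) ((ivec (W (lift ord0 j)) - ivec (W ord0)) *m H) 0 i) *m
   (\matrix_(i, j) (if j == 0 then d i c1 - d i c0 else d i c2 - d i c0)) =
   H^T *m (mx22 (vsub (w c1) (w c0)) (vsub (w c2) (w c0)))^T.
  have col i c c' : \sum_j ((ivec (W (lift ord0 j)) - ivec (W ord0)) *m H) 0 i *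
      (d j c - d j c') = (ivec (vsub (w c) (w c')) *m H) 0 i.
    under eq_bigr do rewrite mulrBr.
    rewrite sumrB !(sel (fun i0 => ((ivec (W i0) - ivec (W ord0)) *m H) 0 i));
      try by rewrite subrr mul0mx mxE.
    by rewrite !Wg ivec_vsub !mulmxBl !mxE; ring.
  have ent i j : (H^T *m (mx22 (vsub (w c1) (w c0)) (vsub (w c2) (w c0)))^T) i j =
     (ivec (if j == 0 then vsub (w c1) (w c0) else vsub (w c2) (w c0)) *m H) 0 i.
    rewrite !mxE; apply: eq_bigr => r _; rewrite !mxE mulrC.
    by case: ifP.
  apply/matrixP=> i j; rewrite ent mxE -(fun_if (fun c => vsub (w c) (w c0))) -col.
  by apply: eq_bigr => r _; rewrite !mxE; case: ifP.
by rewrite unitmx_mul !unitmx_tr Hu mx22_unit.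
Qed.

End Theta.

Theorem theorem4p3 (R : realType) (M' : set 'rV[R]_2) (Q : 'M[R]_2)
  (b : 'I_4 -> 'rV[R]_2) :
  full_lattice M' -> is_polarization M' Q -> principal M' Q ->
  irreducible_ppav M' Q ->
  (forall i, Nlat 2 (b i)) ->
  (forall m, Nlat 2 m -> exists! i : 'I_4,
      exists u, M' u /\ m - b i = lam Q u *+ 2) ->
  [/\ (* theta_b is a genuine minimum (well defined, real valued) *)
      (forall i x, exists u, M' u /\ theta M' Q (b i) x = theta_term Q (b i) x u /\
          forall v, M' v -> theta_term Q (b i) x u <= theta_term Q (b i) x v),
      (* psi is well defined on Y = X / <-1> *)
      (forall x u, M' u ->
          tproj_eq (fun i => theta M' Q (b i) (x + u)) (fun i => theta M' Q (b i) x)),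
      (forall x,
          tproj_eq (fun i => theta M' Q (b i) (- x)) (fun i => theta M' Q (b i) x)),
      (* psi is injective on Y *)
      (forall x y,
          tproj_eq (fun i => theta M' Q (b i) x) (fun i => theta M' Q (b i) y) ->
          exists u, M' u /\ (y = x + u \/ y = - x + u)) &
      (* the composite N_R -> R^3 is unimodular *)
      unimodular setT (psi_map M' Q b)].
Proof.
move=> _ [sQ posQ _] [_ prM] irr /choice[z bz] reps.
have Qu := posdef_unit posQ.
(* Principality in the form M' = Z^2 Q^-1. *)
have latM u : M' u <-> Nlat 2 (u *m Q).
  split=> [Mu|/prM[u' [Mu' e]]]; first by apply/prM; exists u.
  by rewrite -(can_inj (mulmxK Qu) (e : u' *m Q = u *m Q)).
have [H [al [be [ga [Hu al0 be0 ga0 G]]]]] := selling_form sQ posQ latM irr.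
have {bz}bz : b = fun i => intvec R (z i) by exact/funext.
have surj c : exists i, class_of H (z i) = c.
  have [i [[u [/latM[y ey] e]] _]] := reps
    (intvec R (ivec ((c.1 : nat) : int, (c.2 : nat) : int) *m H)) (ex_intro _ _ erefl).
  exists i; rewrite -(class_of_shift H y).
  have <- : ivec ((c.1 : nat) : int, (c.2 : nat) : int) *m H = y *+ 2 + z i.
    by apply: (@intvec_inj R); rewrite mulr2n !intvecD -ey -mulr2n -/(lam Q u) -e bz /= subrK.
  by rewrite class_of_ivec // /parity /= !oddb -surjective_pairing.
have isM i x := theta_is_min sQ Qu latM Hu al0 be0 ga0 G (z i) x.
rewrite bz; split.
- by move=> i x; apply: theta_attained G _ _.
- move=> x _ /(lattice_period Qu latM Hu)[k ->].
  (* The constant of [energy_shift], divided by 4 since the energies are four times the theta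
     values. *)
  exists (energy al be ga (vshift k (0, 0)) (tshift k (coords Q H x)) / 4) => i.
  have := isM i (x + period Q H k); rewrite coords_period // => h.
  have := is_min_uniq h (is_min_shift k (isM i x)); lra.
- move=> x; exists 0 => i; have := isM i (- x); rewrite coordsN => h.
  have := is_min_uniq h (is_min_opp (isM i x)); lra.
- move=> x y [k xy]; have [g gP] := choice surj.
  have M c w : is_min al be ga c (coords Q H w) (4 * theta M' Q (intvec R (z (g c))) w).
    by rewrite -[X in is_min _ _ _ X](gP c).
  have [|s [j e]] := minima_injective (k := 4 * k) al0 be0 ga0 (M^~ x) (M^~ y).
    by move=> c; rewrite xy; ring.
  exists (period Q H j); split; first exact: period_lattice.
  case: s e => e; [right | left]; apply: (coords_inj Qu Hu).
    by rewrite coords_period // coordsN.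
  by rewrite coords_period.
- exact (unimodular_psi sQ Qu latM Hu al0 be0 ga0 G surj).
Qed.
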